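(* Let $a\neq0$ be a real number. An admissible helical surface with nonzero pitch has a constant ratio $a$ of isotropic principal curvatures if and only if it is isotropic similar to a subset of one of the surfaces $$r_a(u,v)=\begin{bmatrix}\cos v\,(\cos u\,\sin^a u)^{-\frac{1}{a+1}}\\ \sin v\,(\cos u\,\sin^a u)^{-\frac{1}{a+1}}\\ v+u+\frac{1}{a^2-1}\tan u+\frac{a^2}{a^2-1}\cot u\end{bmatrix},\qquad\text{if } a\neq\pm1,$$ $$r_c(u,v)=\begin{bmatrix}u\cos v\\ u\sin v\\ c\log u+v\end{bmatrix},\qquad\text{if } a=-1,$$ where $c$ is an arbitrary real constant and $v$ runs through $\mathbb{R}$; in the second formula $u$ runs through $(0,+\infty)$, and in the first formula $u$ runs through a subinterval of $(0,\pi/2)$ on which $\tan^2u\neq a$.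
   Context: We work in $\mathbb{R}^3$ with coordinates $x,y,z$. A surface is an embedded connected 2-dimensional $C^3$ submanifold of $\mathbb{R}^3$, possibly with boundary and possibly non-compact. A surface is admissible if none of its tangent planes is parallel to the $z$-axis; it is then locally a graph $z=f(x,y)$. The isotropic principal curvatures $\kappa_1,\kappa_2$ at a point are the eigenvalues of the Hessian $\nabla^2 f$; $H=\frac{\kappa_1+\kappa_2}{2}$ and $K=\kappa_1\kappa_2$ are the isotropic mean and Gaussian curvatures. An admissible surface has a constant ratio $a$ of isotropic principal curvatures if $K\neq0$ and ($\kappa_1/\kappa_2=a$ or $\kappa_2/\kappa_1=a$) at each of its points; equivalently, $K\ne 0$ and $H^2/K=(a+1)^2/(4a)$. A general isotropic similarity is an invertible affine map $\mathbf{x}\mapsto A\mathbf{x}+\mathbf{b}$ of $\mathbb{R}^3$ with $A=\begin{pmatrix}\pm h_1&\mp h_2&0\\ h_2&h_1&0\\ c_1&c_2&c_3\end{pmatrix}$, $\mathbf b\in\mathbb{R}^3$, $h_1,h_2,c_1,c_2,c_3\in\mathbb{R}$. Two sets are isotropic similar if some general isotropic similarity takes one to the other. A helical motion through the angle $\phi$ about the $z$-axis with pitch $h$ is the composition of the rotation through the angle $\phi$ about the $z$-axis and the translation by $h\phi$ in the $z$-direction. A surface invariant under these helical motions for fixed $h$ and all $\phi\in\mathbb{R}$ is called helical with pitch $h$. *)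

(* Defs.v *)
From HB Require Import structures.
From mathcomp Require Import all_boot all_order all_algebra.
From mathcomp Require Import all_classical all_reals all_analysis.

Set Implicit Arguments.
Unset Strict Implicit.
Unset Printing Implicit Defensive.

Import Order.TTheory GRing.Theory Num.Theory.
Import numFieldNormedType.Exports.

Local Open Scope classical_set_scope.
Local Open Scope ring_scope.

(* Points of R^2 and R^3 are row vectors. *)
Definition pt3 (R : realType) (x y z : R) : 'rV[R]_3 :=
  \row_(i < 3) nth 0 [:: x; y; z] i.

Definition xy (R : realType) (p : 'rV[R]_3) : 'rV[R]_2 :=
  \row_(i < 2) nth 0 [:: p 0 0; p 0 1] i.

(* All partial derivatives of order at most k exist and are continuous on U.
   The notion is meant for open U: the values of f outside U are irrelevant. *)
Fixpoint Ck_on (R : realType) (n : nat) (W : normedModType R) (k : nat)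
    (U : set 'rV[R]_n.+1) (f : 'rV[R]_n.+1 -> W) : Prop :=
  (forall x, U x -> {for x, continuous f}) /\
  if k is k'.+1 then
    forall i : 'I_n.+1,
      (forall x, U x -> derivable f x (delta_mx 0 i)) /\
      Ck_on k' U (fun x => 'D_(delta_mx 0 i) f x)
  else True.

Definition C3_diffeo (R : realType) (U V : set 'rV[R]_3)
    (Phi Psi : 'rV[R]_3 -> 'rV[R]_3) : Prop :=
  [/\ open U, open V, Ck_on 3 U Phi & Ck_on 3 V Psi] /\
  [/\ forall x, U x -> V (Phi x), forall y, V y -> U (Psi y),
      forall x, U x -> Psi (Phi x) = x & forall y, V y -> Phi (Psi y) = y].

(* A chart of R^3 around p straightening S to the closed half-plane
   {y_0 >= 0, y_2 = 0}. If p is sent to y_0 > 0 it is an interior point of S,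
   if it is sent to y_0 = 0 it is a boundary point. *)
Definition straightening_chart (R : realType) (S : set 'rV[R]_3)
    (p : 'rV[R]_3) (U V : set 'rV[R]_3) (Phi Psi : 'rV[R]_3 -> 'rV[R]_3) :=
  [/\ U p, C3_diffeo U V Phi Psi &
      Phi @` (S `&` U) = V `&` [set y | 0 <= y 0 0 /\ y 0 2 = 0]].

(* Embedded connected (nonempty) 2-dimensional C^3 submanifold of R^3,
   possibly with boundary, not necessarily closed or bounded. *)
Definition surface (R : realType) (S : set 'rV[R]_3) : Prop :=
  [/\ S !=set0, connected S &
      forall p, S p -> exists U V Phi Psi, straightening_chart S p U V Phi Psi].

(* The preimage of the plane {y_2 = 0} under the differential at p of a
   straightening chart Phi; it does not depend on the chart. *)
Definition tangent_space (R : realType) (S : set 'rV[R]_3) (p : 'rV[R]_3) :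
    set 'rV[R]_3 :=
  [set v | exists U V Phi Psi, straightening_chart S p U V Phi Psi /\
     ('D_v Phi p : 'rV[R]_3) 0 2 = 0].

Definition admissible (R : realType) (S : set 'rV[R]_3) : Prop :=
  forall p, S p -> ~ tangent_space S p (pt3 0 0 1).

(* Near p the set S lies on the graph z = f(x,y) of a function f of class C^3
   in a neighbourhood of (p_x, p_y). At a boundary point of a surface, f extends
   the function whose graph S is. As the projection to the (x,y)-plane of an
   admissible surface near p is contained in the closure of its interior, the
   derivatives of f at (p_x, p_y) up to order 3 are determined by S. *)
Definition local_graph (R : realType) (S : set 'rV[R]_3) (p : 'rV[R]_3)
    (f : 'rV[R]_2 -> R) : Prop :=
  (exists W, [/\ open W, W (xy p) & Ck_on 3 W f]) /\
  (exists U, [/\ open U, U p & forall q, S q -> U q -> q 0 2 = f (xy q)]).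

Definition hessian (R : realType) (f : 'rV[R]_2 -> R) (x : 'rV[R]_2) :
    'M[R]_2 :=
  \matrix_(i, j)
    'D_(delta_mx 0 i) (fun y => 'D_(delta_mx 0 j) f y : R) x.

(* k1 and k2 are the eigenvalues, with multiplicity, of the Hessian. *)
Definition iso_principal_curvatures (R : realType) (S : set 'rV[R]_3)
    (p : 'rV[R]_3) (k1 k2 : R) : Prop :=
  exists f, local_graph S p f /\
    char_poly (hessian f (xy p)) = ('X - k1%:P) * ('X - k2%:P).

Definition constant_ratio (R : realType) (a : R) (S : set 'rV[R]_3) : Prop :=
  forall p, S p -> exists k1 k2,
    [/\ iso_principal_curvatures S p k1 k2, k1 * k2 != 0 &
        k1 / k2 = a \/ k2 / k1 = a].

(* The sign + or - of the first row of the matrix is (-1) ^+ s. *)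
Definition iso_similarity_mx (R : realType) (s : bool) (h1 h2 c1 c2 c3 : R) :
    'M[R]_3 :=
  \matrix_(i < 3, j < 3)
    nth 0 (nth [::] [:: [:: (-1) ^+ s * h1; - ((-1) ^+ s * h2); 0];
                        [:: h2; h1; 0];
                        [:: c1; c2; c3]] i) j.

(* Points being row vectors, x |-> A x + b reads x |-> x *m A^T + b. *)
Definition iso_similarity (R : realType) (g : 'rV[R]_3 -> 'rV[R]_3) : Prop :=
  exists s h1 h2 c1 c2 c3 (b : 'rV[R]_3),
    let A := iso_similarity_mx s h1 h2 c1 c2 c3 in
    A \in unitmx /\ forall x, g x = x *m A^T + b.

Definition iso_similar (R : realType) (S T : set 'rV[R]_3) : Prop :=
  exists g, iso_similarity g /\ g @` S = T.

Definition helical_motion (R : realType) (h phi : R) (p : 'rV[R]_3) :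
    'rV[R]_3 :=
  pt3 (cos phi * p 0 0 - sin phi * p 0 1)
      (sin phi * p 0 0 + cos phi * p 0 1)
      (p 0 2 + h * phi).

Definition helical (R : realType) (h : R) (S : set 'rV[R]_3) : Prop :=
  forall phi, helical_motion h phi @` S = S.

Definition r_a (R : realType) (a u v : R) : 'rV[R]_3 :=
  let rho := (cos u * sin u `^ a) `^ (- (a + 1)^-1) in
  pt3 (cos v * rho) (sin v * rho)
      (v + u + (a ^+ 2 - 1)^-1 * tan u
             + a ^+ 2 / (a ^+ 2 - 1) * (cos u / sin u)).

Definition r_c (R : realType) (c u v : R) : 'rV[R]_3 :=
  pt3 (u * cos v) (u * sin v) (c * ln u + v).

(* The intervals may be open, closed or half-open, but not reduced to a
   point, in which case r_a would parametrize a curve. *)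
Definition parameter_interval (R : realType) (a : R) (I : set R) : Prop :=
  [/\ is_interval I, exists u1 u2, [/\ I u1, I u2 & u1 < u2],
      I `<=` [set u | 0 < u < pi / 2] &
      forall u, I u -> tan u ^+ 2 != a].

Definition surface_r_a (R : realType) (a : R) (I : set R) : set 'rV[R]_3 :=
  [set p | exists u v, I u /\ p = r_a a u v].

Definition surface_r_c (R : realType) (c : R) : set 'rV[R]_3 :=
  [set p | exists u v, 0 < u /\ p = r_c c u v].

(* Main.v *)
Require Import Defs.
From mathcomp Require Import all_boot all_order all_algebra.
From mathcomp Require Import all_classical all_reals all_analysis.
From mathcomp Require Import ring lra.

Set Implicit Arguments.
Unset Strict Implicit.
Unset Printing Implicit Defensive.

Import Order.TTheory GRing.Theory Num.Theory.
Import numFieldNormedType.Exports.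
Local Open Scope classical_set_scope.
Local Open Scope ring_scope.

(* Since the surface is locally a graph it avoids the z-axis, and near each point
   it is the set of all (r cos psi, r sin psi, F r + h psi) with r in an interval
   J. This J is not reduced to a point, because otherwise the polar angle would
   embed a half-disc in a line. Hence the Hessian of any function of which the
   surface is locally the graph is the one of F r + h psi, at boundary points by
   continuity of the derivatives.

   Let h = 1. In an orthonormal polar frame, r^2 times the Hessian is
   [[L - s, -1], [-1, s]] with s = r F' and L = r s'. If its eigenvalues are k and
   a k, then (a k - s) (s - k) = 1. For a = 1 this is impossible, and for a = -1 it
   gives s' = 0, so that F is c log r up to a constant. Otherwise, after a
   reflection, t = a k - s is positive and u = atan t is the parameter of the
   surface r_a: from (a - 1) s = t + a / t and (a - 1) k = t + 1 / t one gets
   r t' (t^2 - a) = (1 + a) t (t^2 + 1), hence tan^2 u <> a, and the first integrals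
   (a + 1) log r + log (cos u sin^a u) and
   F - u - tan u / (a^2 - 1) - a^2 cot u / (a^2 - 1). These are locally constant on
   the surface, hence constant by connectedness.

   Conversely, the radius of r_a has an inverse function t of r on each component
   of {tan^2 u <> a}, so r_a is locally a graph of class C^3, and its Hessian is
   found by the same formulas. A general isotropic similarity multiplies the Hessian
   by a constant after conjugation by an orthogonal matrix. *)

(** * Functions with continuous partial derivatives *)

(** Through this reduction the chain rule of one variable covers functions of which only directional
    derivatives are known. *)
Lemma is_derive_lineE (R : realType) (V : normedModType R) (f : V -> R)
    (x v : V) (d : R) :
  is_derive x v f d <-> is_derive (0 : R) 1 (fun t : R => f (t *: v + x)) d.
Proof.
have E : (fun h : R => h^-1 *: ((f \o shift x) (h *: v) - f x)) =
    (fun h : R => h^-1 *: (((fun t : R => f (t *: v + x)) \o shift 0) (h *: 1)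
      - (fun t : R => f (t *: v + x)) 0)).
  by apply/funext => t /=; rewrite addr0 scale0r add0r [_%:A]mulr1.
by split=> -[df fd]; split; move: df fd; rewrite /derivable /derive E.
Qed.

Lemma is_derive_comp (R : realType) (V : normedModType R) (g : R -> R)
    (f : V -> R) (x v : V) (a b : R) :
  is_derive (f x) 1 g a -> is_derive x v f b ->
  is_derive x v (fun y => g (f y)) (a * b).
Proof.
move=> dg /is_derive_lineE df; apply/is_derive_lineE.
apply: (@is_derive1_comp R g (fun t : R => f (t *: v + x)) 0 a b).
by rewrite scale0r add0r.
Qed.

Lemma is_derive_inv (R : realType) (V : normedModType R) (f : V -> R)
    (x v : V) (d : R) : f x != 0 ->
  is_derive x v f d -> is_derive x v (fun y => (f y)^-1) (- f x ^- 2 * d).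
Proof.
move=> f0 df; apply: is_derive_comp.
rewrite -[X in is_derive _ _ _ X]mulr1.
exact: (@is_deriveV R id).
Qed.

Lemma is_derive_mul (R : realType) (V : normedModType R) (f g : V -> R)
    (x v : V) (df dg : R) : is_derive x v f df -> is_derive x v g dg ->
  is_derive x v (fun y => f y * g y) (f x * dg + g x * df).
Proof. by move=> Df Dg; apply: is_deriveM. Qed.

Lemma is_derive_add (R : realType) (V : normedModType R) (f g : V -> R)
    (x v : V) (df dg : R) : is_derive x v f df -> is_derive x v g dg ->
  is_derive x v (fun y => f y + g y) (df + dg).
Proof. by move=> Df Dg; apply: is_deriveD. Qed.

Lemma is_derive_scale (R : realType) (V : normedModType R) (c : R) (f : V -> R)
    (x v : V) (d : R) :
  is_derive x v f d -> is_derive x v (fun y => c * f y) (c * d).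
Proof.
move=> Df; apply: (is_derive_eq (is_derive_mul (is_derive_cst c x v) Df)).
by rewrite mulr0 addr0.
Qed.

(* Scalar functions all of whose partial derivatives of order at most k along
   the directions e are continuous; it covers both [Ck_on] on R^n and functions
   of one variable. *)
Fixpoint Ck (R : realType) (V : normedModType R) (I : Type) (e : I -> V)
    (k : nat) (U : set V) (f : V -> R) : Prop :=
  (forall x, U x -> {for x, continuous f}) /\
  if k is k'.+1 then
    forall i : I, (forall x, U x -> derivable f x (e i)) /\
      Ck e k' U (fun x => 'D_(e i) f x)
  else True.

Definition Ck1 (R : realType) (k : nat) (U : set R) (g : R -> R) : Prop :=
  Ck (fun _ : unit => 1 : R) k U g.

Notation delta_row n := (fun i : 'I_n => delta_mx (0 : 'I_1) i).

Section CkTheory.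
Variables (R : realType) (V : normedModType R) (I : Type) (e : I -> V).
Implicit Types (f g : V -> R) (U W : set V) (k : nat).

Lemma Ck_continuous k U f x : Ck e k U f -> U x -> {for x, continuous f}.
Proof. by case: k => [|k] [+ _]; apply. Qed.

Lemma Ck_derivable k U f x i : Ck e k.+1 U f -> U x -> derivable f x (e i).
Proof. by move=> [_ /(_ i)[+ _]]; apply. Qed.

Lemma Ck_is_derive k U f x i : Ck e k.+1 U f -> U x ->
  is_derive x (e i) f ('D_(e i) f x).
Proof. by move=> Cf Ux; apply: derivableP; apply: Ck_derivable Cf Ux. Qed.

Lemma Ck_derive k U f i : Ck e k.+1 U f -> Ck e k U (fun x => 'D_(e i) f x).
Proof. by move=> [_ /(_ i)[]]. Qed.

Lemma CkS k U f : Ck e k.+1 U f -> Ck e k U f.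
Proof.
elim: k f => [|k IH] f [cf Df]; split=> // i.
by have [df Cdf] := Df i; split=> //; apply: IH.
Qed.

Lemma Ck_subset k U W f : W `<=` U -> Ck e k U f -> Ck e k W f.
Proof.
move=> WU; elim: k f => [|k IH] f [cf Df]; first by split=> // x /WU; exact: cf.
split=> [x /WU|i]; first exact: cf.
by have [df Cdf] := Df i; split=> [x /WU|]; [exact: df|exact: IH].
Qed.

(** Openness of [U] turns equality on [U] into equality near each of its points, which is what
    continuity and derivatives see. *)
Lemma Ck_ext k U f g : open U -> (forall x, U x -> f x = g x) ->
  Ck e k U f -> Ck e k U g.
Proof.
move=> oU; elim: k f g => [|k IH] f g fg [cf Df].
  split=> // x Ux; have : {near x, f =1 g}.
    by apply: filterS (open_nbhs_nbhs (conj oU Ux)); exact: fg.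
  move=> nfg; have := cf x Ux; rewrite /prop_for /continuous_at (fg x Ux) => h.
  by apply: cvg_trans h; apply: near_eq_cvg; apply: filterS nfg => y ->.
have nfg x : U x -> {near x, f =1 g}.
  by move=> Ux; apply: filterS (open_nbhs_nbhs (conj oU Ux)); exact: fg.
split=> [x Ux|i].
  have := cf x Ux; rewrite /prop_for /continuous_at (fg x Ux) => h.
  by apply: cvg_trans h; apply: near_eq_cvg; apply: filterS (nfg x Ux) => y ->.
have [df Cdf] := Df i; split=> [x Ux|].
  by apply: near_eq_derivable (nfg x Ux) _; apply: df.
by apply: IH Cdf => x Ux; apply: near_eq_derive; exact: nfg.
Qed.

Lemma Ck_intro k U f (df : I -> V -> R) : open U ->
  (forall x, U x -> {for x, continuous f}) ->
  (forall i x, U x -> is_derive x (e i) f (df i x)) ->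
  (forall i, Ck e k U (df i)) -> Ck e k.+1 U f.
Proof.
move=> oU cf Df Cdf; split=> // i; split=> [x Ux|].
  by have [] := Df i x Ux.
by apply: Ck_ext (Cdf i) => // x Ux; have [_ ->] := Df i x Ux.
Qed.

Lemma Ck_cst k U (c : R) : open U -> Ck e k U (fun=> c).
Proof.
move=> oU; elim: k c => [|k IH] c; first by split=> // x _; exact: cvg_cst.
apply: (Ck_intro (df := fun _ _ => 0)) => //.
by move=> x _; exact: cvg_cst.
Qed.

Lemma CkD k U f g : open U -> Ck e k U f -> Ck e k U g ->
  Ck e k U (fun x => f x + g x).
Proof.
move=> oU; elim: k f g => [|k IH] f g Cf Cg.
  by split=> // x Ux; apply: continuousD;
    [exact: Ck_continuous Cf Ux|exact: Ck_continuous Cg Ux].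
apply: (Ck_intro (df := fun i x => 'D_(e i) f x + 'D_(e i) g x)) => //.
- by move=> x Ux; apply: continuousD;
    [exact: Ck_continuous Cf Ux|exact: Ck_continuous Cg Ux].
- move=> i x Ux; apply: is_deriveD;
    [exact: Ck_is_derive Cf Ux|exact: Ck_is_derive Cg Ux].
- by move=> i; apply: IH; [case: (Cf.2 i)|case: (Cg.2 i)].
Qed.

Lemma CkM k U f g : open U -> Ck e k U f -> Ck e k U g ->
  Ck e k U (fun x => f x * g x).
Proof.
move=> oU; elim: k f g => [|k IH] f g Cf Cg.
  by split=> // x Ux; apply: continuousM;
    [exact: Ck_continuous Cf Ux|exact: Ck_continuous Cg Ux].
apply: (Ck_intro (df := fun i x => f x * 'D_(e i) g x + g x * 'D_(e i) f x)).
- by [].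
- by move=> x Ux; apply: continuousM;
    [exact: Ck_continuous Cf Ux|exact: Ck_continuous Cg Ux].
- move=> i x Ux; apply: is_deriveM;
    [exact: Ck_is_derive Cf Ux|exact: Ck_is_derive Cg Ux].
- move=> i; have [Df _] := Cf; have [Dg _] := Cg.
  apply: CkD => //; apply: IH.
  + exact: CkS.
  + by case: (Cg.2 i).
  + exact: CkS.
  + by case: (Cf.2 i).
Qed.

Lemma CkZ k U (c : R) f : open U -> Ck e k U f -> Ck e k U (fun x => c * f x).
Proof. by move=> oU Cf; apply: CkM => //; exact: Ck_cst. Qed.

Lemma CkN k U f : open U -> Ck e k U f -> Ck e k U (fun x => - f x).
Proof.
move=> oU Cf; apply: Ck_ext (CkZ (-1) oU Cf) => // x _; exact: mulN1r.
Qed.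

Lemma CkB k U f g : open U -> Ck e k U f -> Ck e k U g ->
  Ck e k U (fun x => f x - g x).
Proof. by move=> oU Cf Cg; apply: CkD => //; exact: CkN. Qed.

End CkTheory.

Lemma Ck_comp (R : realType) (V : normedModType R) (I : Type) (e : I -> V) k
    (U : set V) (A : set R) (g : R -> R) (f : V -> R) : open U ->
  (forall x, U x -> A (f x)) -> Ck1 k A g -> Ck e k U f ->
  Ck e k U (fun x => g (f x)).
Proof.
move=> oU UA; elim: k g => [|k IH] g Cg Cf.
  split=> // x Ux; apply: continuous_comp; first exact: Ck_continuous Cf Ux.
  exact: (Ck_continuous Cg (UA _ Ux)).
apply: (Ck_intro (df := fun i x => 'D_1 g (f x) * 'D_(e i) f x)) => //.
- move=> x Ux; apply: continuous_comp; first exact: Ck_continuous Cf Ux.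
  exact: (Ck_continuous Cg (UA _ Ux)).
- move=> i x Ux; apply: is_derive_comp; last exact: Ck_is_derive Cf Ux.
  exact: (Ck_is_derive tt Cg (UA _ Ux)).
- move=> i; apply: CkM => //; last by case: (Cf.2 i).
  by apply: (IH (fun y => 'D_1 g y)); [case: (Cg.2 tt)|exact: CkS].
Qed.

Lemma Ck_onE (R : realType) n k (U : set 'rV[R]_n.+1) (f : 'rV[R]_n.+1 -> R) :
  Ck_on k U f <-> Ck (fun i => delta_mx 0 i) k U f.
Proof.
by elim: k f => [|k IH] f //=; split=> -[cf Df]; split=> // i;
  have [df Cdf] := Df i; split=> //; apply/IH.
Qed.

Lemma is_derive1_continuous (R : realType) (f : R -> R) (x d : R) :
  is_derive x 1 f d -> {for x, continuous f}.
Proof.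
by move=> [df _]; apply/differentiable_continuous/derivable1_diffP.
Qed.

Lemma Ck1_intro (R : realType) k (U : set R) (g dg : R -> R) : open U ->
  (forall x, U x -> is_derive x 1 g (dg x)) -> Ck1 k U dg -> Ck1 k.+1 U g.
Proof.
move=> oU Dg Cdg; apply: (@Ck_intro _ _ _ _ _ _ _ (fun _ => dg)) => //.
by move=> x Ux; exact: is_derive1_continuous (Dg x Ux).
Qed.

Lemma Ck1_is_derive (R : realType) k (U : set R) (g : R -> R) x :
  Ck1 k.+1 U g -> U x -> is_derive x 1 g ('D_1 g x).
Proof. by move=> Cg Ux; exact: (Ck_is_derive tt Cg Ux). Qed.

Lemma Ck1_derive (R : realType) k (U : set R) (g : R -> R) :
  Ck1 k.+1 U g -> Ck1 k U (fun x => 'D_1 g x).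
Proof. by move=> Cg; case: (Cg.2 tt). Qed.

Lemma Ck1_id (R : realType) k (U : set R) : open U -> Ck1 k U id.
Proof.
move=> oU; case: k => [|k]; first by split=> // x _; exact: cvg_id.
by apply: (@Ck1_intro _ _ _ _ (fun _ => 1)) => //; exact: Ck_cst.
Qed.

Lemma is_derive_coord (R : realType) n (x : 'rV[R]_n) (i j : 'I_n) :
  is_derive x (delta_mx 0 i) (fun v : 'rV[R]_n => v 0 j) (i == j)%:R.
Proof.
apply/is_derive_lineE.
have -> : (fun t : R => (t *: delta_mx 0 i + x) 0 j) =
    (fun t : R => t * (i == j)%:R + x 0 j).
  by apply/funext => t; rewrite !mxE eqxx eq_sym.
apply: (@is_derive_eq _ _ _ (id * cst (i == j)%:R + cst (x 0 j))).
by rewrite /= scaler0 add0r addr0 [_%:A]mulr1.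
Qed.

Lemma Ck1V (R : realType) k : Ck1 k [set x : R | x != 0] GRing.inv.
Proof.
have oU : open [set x : R | x != 0] by exact: open_neq.
have cV (x : R) : x != 0 -> {for x, continuous (@GRing.inv R)}.
  exact: inv_continuous.
elim: k => [|k IH]; first by split.
apply: (@Ck1_intro _ _ _ _ (fun x => - (x^-1 * x^-1))) => //.
- move=> x x0.
  have -> : - (x^-1 * x^-1) = - x ^- 2 *: 1 :> R.
    by rewrite -invrM ?unitfE// [_%:A]mulr1.
  exact: (@is_deriveV R id).
- by apply: CkN => //; apply: CkM.
Qed.

Lemma Ck1_sqrt (R : realType) k : Ck1 k [set x : R | 0 < x] Num.sqrt.
Proof.
have oU : open [set x : R | 0 < x] by exact: open_gt.
elim: k => [|k IH]; first by split=> // x _; exact: sqrt_continuous.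
apply: (@Ck1_intro _ _ _ _ (fun x => (2 * Num.sqrt x)^-1)) => //.
apply: (@Ck_comp _ _ _ _ _ _ [set x : R | x != 0]) => //.
- by move=> x /= x0; rewrite gt_eqF// mulr_gt0// sqrtr_gt0.
- exact: Ck1V.
- exact: CkZ.
Qed.

Lemma Ck1_atan (R : realType) k : Ck1 k [set: R] atan.
Proof.
case: k => [|k]; first by split=> // x _; exact: continuous_atan.
apply: (@Ck1_intro _ _ _ _ (fun x => (1 + x * x)^-1)).
- exact: openT.
- apply: (@Ck_comp _ _ _ _ _ _ [set x : R | x != 0]) => //.
  + exact: openT.
  + by move=> x _ /=; rewrite gt_eqF// ltr_wpDr// -expr2 sqr_ge0.
  + exact: Ck1V.
  + by apply: CkD; [exact: openT|exact: Ck_cst openT|];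
      apply: CkM; try exact: openT; apply: Ck1_id; exact: openT.
Qed.

Lemma Ck1_ln (R : realType) k : Ck1 k [set x : R | 0 < x] (@ln R).
Proof.
have oU : open [set x : R | 0 < x] by exact: open_gt.
case: k => [|k]; first by split=> // x /= x0; exact: continuous_ln.
apply: (@Ck1_intro _ _ _ _ GRing.inv) => //.
apply: Ck_subset (Ck1V R k) => x /= x0; by rewrite gt_eqF.
Qed.

(* Applied to partial derivatives, this determines them at the boundary points of
   a surface. *)
Lemma eq_continuous_closure (R : realType) (V : normedModType R)
    (f g : V -> R) (O : set V) (x : V) :
  {for x, continuous f} -> {for x, continuous g} -> closure O x ->
  (forall y, O y -> f y = g y) -> f x = g x.
Proof.
move=> cf cg clO fg; apply/eqP; rewrite -subr_eq0; apply/negPn/negP => d0.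
have : {for x, continuous (fun y => f y - g y)} by apply: continuousB.
move=> /(_ [set t | t != 0]) /=.
have nb : nbhs (f x - g x) [set t : R | t != 0].
  by apply: open_nbhs_nbhs; split=> //; exact: open_neq.
move=> /(_ nb)/clO[y [Oy /=]]; by rewrite fg// subrr eqxx.
Qed.

Section Jets.
Variables (R : realType) (V : normedModType R) (I : Type) (e : I -> V).
Variables (U O : set V) (f g : V -> R).
Hypothesis (oO : open O) (fg : forall y, O y -> f y = g y).

Lemma eq_derive_open i y : O y -> 'D_(e i) f y = 'D_(e i) g y.
Proof.
move=> Oy; apply: near_eq_derive.
by apply: filterS (open_nbhs_nbhs (conj oO Oy)); exact: fg.
Qed.

Lemma eq_jet1 x i : Ck e 1 U f -> Ck e 1 U g -> U x -> closure O x ->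
  'D_(e i) f x = 'D_(e i) g x.
Proof.
move=> [_ Cf] [_ Cg] Ux clO.
apply: eq_continuous_closure clO (eq_derive_open i).
  exact: ((Cf i).2.1 x Ux).
exact: ((Cg i).2.1 x Ux).
Qed.

End Jets.

(** The first derivatives of [f] and [g] agree on the open set [O], so [eq_jet1] applies to them. *)
Lemma eq_jet2 (R : realType) (V : normedModType R) (I : Type) (e : I -> V)
    (U O : set V) (f g : V -> R) x i j :
  open O -> (forall y, O y -> f y = g y) ->
  Ck e 2 U f -> Ck e 2 U g -> U x -> closure O x ->
  'D_(e i) (fun y => 'D_(e j) f y) x = 'D_(e i) (fun y => 'D_(e j) g y) x.
Proof.
move=> oO fg [_ Cf] [_ Cg] Ux clO.
apply: (@eq_jet1 _ _ _ _ U O) => //; [|exact: (Cf j).2|exact: (Cg j).2].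
by move=> y Oy; exact: (eq_derive_open e oO fg).
Qed.

(** * The Hessian of a helical function *)

Section PolarFunction.
Variables (R : realType) (V : normedModType R) (I : Type) (e : I -> V).
Variables (X Y : V -> R) (dX dY : I -> R).
Hypotheses (cX : continuous X) (cY : continuous Y).
Hypotheses (dXE : forall i v, is_derive v (e i) X (dX i)).
Hypotheses (dYE : forall i v, is_derive v (e i) Y (dY i)).

(** [X] and [Y] stand for affine coordinates: their derivatives along [e i] are the constants [dX i]
    and [dY i]. They will be rotated coordinates of the plane, or its coordinates after a
    similarity. *)
Definition radius (v : V) : R := Num.sqrt (X v * X v + Y v * Y v).

(* The helical function F(r) + h * theta in the polar coordinates of (X, Y),
   on the half-plane X > 0. *)
Definition helical_fun (F : R -> R) (h : R) (v : V) : R :=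
  F (radius v) + h * atan (Y v / X v).

Definition polar_dom (A : set R) : set V := [set v | 0 < X v /\ A (radius v)].

Lemma radius_continuous : continuous radius.
Proof.
move=> v; apply: continuous_comp; last exact: sqrt_continuous.
by apply: continuousD; apply: continuousM; (exact: cX || exact: cY).
Qed.

Lemma polar_dom_open (A : set R) : open A -> open (polar_dom A).
Proof.
move=> oA; apply: openI; last first.
  by apply: open_comp oA => v _; exact: radius_continuous.
by apply: (@open_comp _ _ X [set x | 0 < x]) => [v _|]; [exact: cX|exact: open_gt].
Qed.

Lemma radius_gt0 v : 0 < X v -> 0 < radius v.
Proof. by move=> X0; rewrite sqrtr_gt0 ltr_pwDl ?mulr_gt0// -expr2 sqr_ge0. Qed.

Lemma radius_sqr v : radius v * radius v = X v * X v + Y v * Y v.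
Proof. by rewrite -expr2 sqr_sqrtr// addr_ge0// -expr2 sqr_ge0. Qed.

Lemma Ck_affine k U Z dZ : open U -> continuous Z ->
  (forall i v, is_derive v (e i) Z (dZ i)) -> Ck e k U Z.
Proof.
move=> oU cZ DZ; case: k => [|k]; first by split=> // x _; exact: cZ.
apply: (Ck_intro (df := fun i _ => dZ i)) => //.
- by move=> x _; exact: cZ.
- by move=> i; exact: Ck_cst.
Qed.

Lemma Ck_helical_fun k (A : set R) F h : open A -> Ck1 k A F ->
  Ck e k (polar_dom A) (helical_fun F h).
Proof.
move=> oA CF; have oU := polar_dom_open oA.
have CX : Ck e k (polar_dom A) X by exact: Ck_affine cX dXE.
have CY : Ck e k (polar_dom A) Y by exact: Ck_affine cY dYE.
apply: CkD => //.
  apply: (Ck_comp _ _ CF) => //; first by move=> v [].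
  apply: (Ck_comp _ _ (Ck1_sqrt R k)) => //.
    by move=> v [X0 _] /=; rewrite ltr_pwDl ?mulr_gt0// -expr2 sqr_ge0.
  by apply: CkD => //; apply: CkM.
apply: CkZ => //; apply: (Ck_comp _ _ (Ck1_atan R k)) => //.
apply: CkM => //; apply: (Ck_comp _ _ (Ck1V R k)) => //.
by move=> v [X0 _] /=; rewrite gt_eqF.
Qed.

Local Notation r := radius.
(** Divided by r and by r^2, these are the derivatives of the radius and of the polar angle. *)
Let N i v := X v * dX i + Y v * dY i.
Let M i v := X v * dY i - Y v * dX i.

Lemma is_derive_radius i v : 0 < X v ->
  is_derive v (e i) r (N i v / r v).
Proof.
move=> X0; have r0 := radius_gt0 X0; rewrite /radius.
apply: (is_derive_eq (f' := (2 * r v)^-1 *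
  ((X v * dX i + X v * dX i) + (Y v * dY i + Y v * dY i)))).
  apply: (@is_derive_comp R V Num.sqrt (fun v => X v * X v + Y v * Y v)).
  by apply: is_derive1_sqrt; rewrite -radius_sqr mulr_gt0.
by rewrite /N -/(r v); field; rewrite gt_eqF.
Qed.

Lemma is_derive_angle i v : 0 < X v ->
  is_derive v (e i) (fun v => atan (Y v / X v)) (M i v / (r v * r v)).
Proof.
move=> X0; have r0 := radius_gt0 X0.
apply: (is_derive_eq (f' := (1 + (Y v / X v) ^+ 2)^-1 *
  (Y v * (- (X v) ^- 2 * dX i) + (X v)^-1 * dY i))).
  apply: (@is_derive_comp R V atan (fun v => Y v / X v)).
  by apply: is_deriveM; apply: is_derive_inv; rewrite gt_eqF.
rewrite radius_sqr /M; field.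
by rewrite -!expr2 !gt_eqF// ltr_pwDl ?exprn_gt0// sqr_ge0.
Qed.

Lemma is_derive_helical_fun F h (dF : R) i v : 0 < X v ->
  is_derive (r v) 1 F dF ->
  is_derive v (e i) (helical_fun F h)
    (dF * (N i v / r v) + h * (M i v / (r v * r v))).
Proof.
move=> X0 DF; apply: is_deriveD.
  by apply: is_derive_comp DF _; exact: is_derive_radius.
apply: (is_derive_eq (f' := h * (M i v / (r v * r v)) +
  atan (Y v / X v) * 0)); last by rewrite mulr0 addr0.
by apply: is_deriveM; exact: is_derive_angle.
Qed.

Lemma derive2_helical_fun F dF (ddF h : R) A i j v : open A ->
  polar_dom A v -> (forall x, A x -> is_derive x 1 F (dF x)) ->
  is_derive (r v) 1 dF ddF ->
  'D_(e j) (fun u => 'D_(e i) (helical_fun F h) u) v =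
    ddF * (N i v * N j v / r v ^+ 2)
    + dF (r v) * ((dX i * dX j + dY i * dY j) / r v - N i v * N j v / r v ^+ 3)
    + h * ((dX j * dY i - dY j * dX i) / r v ^+ 2
           - 2 * M i v * N j v / r v ^+ 4).
Proof.
move=> oA Uv DF DdF; have [X0 Av] := Uv; have r0 := radius_gt0 X0.
(* Only the first derivative near [v] matters. There it equals the explicit function [G], to which
   the product rule applies. *)
pose G u := dF (r u) * (N i u * (r u)^-1) + h * (M i u * ((r u)^-1 * (r u)^-1)).
transitivity ('D_(e j) G v).
  apply: near_eq_derive.
  apply: filterS (open_nbhs_nbhs (conj (polar_dom_open oA) Uv)) => u [Xu Au].
  have [_ ->] := is_derive_helical_fun h i Xu (DF _ Au).
  by rewrite /G invfM.
have Dr := is_derive_radius j X0.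
have DV : is_derive v (e j) (fun u => (r u)^-1) (- r v ^- 2 * (N j v / r v)).
  by apply: is_derive_inv => //; rewrite gt_eqF.
have Dcst (c : R) : is_derive v (e j) (fun=> c) 0 by exact: is_derive_cst.
have DN : is_derive v (e j) (N i) ((X v * 0 + dX i * dX j) + (Y v * 0 + dY i * dY j)).
  by apply: is_deriveD; apply: is_deriveM.
have DM : is_derive v (e j) (M i) ((X v * 0 + dY i * dX j) - (Y v * 0 + dX i * dY j)).
  by apply: is_deriveB; apply: is_deriveM.
have D1 := is_derive_mul (is_derive_comp DdF Dr) (is_derive_mul DN DV).
have D2 := is_derive_mul (Dcst h) (is_derive_mul DM (is_derive_mul DV DV)).
have [_ ->] := is_derive_add D1 D2.
field.
by rewrite gt_eqF.
Qed.

End PolarFunction.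

(** * The differential equation of the profile *)

Definition nondegenerate (R : realType) (J : set R) : Prop :=
  exists x y, [/\ J x, J y & x < y].

(** Interior points approach [x] from a side on which [J] has a further point: from the right if x <
    x1, otherwise from the left, as then x0 < x. *)
Lemma interval_closure_interior (R : realType) (J : set R) x :
  is_interval J -> nondegenerate J -> J x -> closure J° x.
Proof.
move=> iJ [x0 [x1 [J0 J1 x01]]] Jx B nB.
have int (u v y : R) : J u -> J v -> u < y < v -> J° y.
  move=> Ju Jv /andP[uy yv]; apply: (@filterS _ _ _ `]u, v[%classic).
    by move=> z; rewrite /= in_itv /= => /andP[uz zv]; apply: (iJ u v) => //; rewrite !ltW.
  by apply: near_in_itvoo; rewrite in_itv /= uy.
have [xx1|x1x] := ltP x x1.
  have n1 : \forall y \near x^'+, B y by apply: filterS nB => y By _.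
  near x^'+ => y; exists y; split; last by near: y.
  by apply: int Jx J1 _; apply/andP; split; near: y;
    [exact: nbhs_right_gt|exact: nbhs_right_lt].
have x0x := lt_le_trans x01 x1x.
have n1 : \forall y \near x^'-, B y by apply: filterS nB => y By _.
near x^'- => y; exists y; split; last by near: y.
by apply: int J0 Jx _; apply/andP; split; near: y;
  [exact: nbhs_left_gt|exact: nbhs_left_lt].
Unshelve. all: by end_near. Qed.

(** A change of sign would produce a zero, by the intermediate value theorem. This will fix the
    signs of t, of t^2 - a and of tan^2 u - a. *)
Lemma interval_sign (R : realType) (J : set R) (f : R -> R) x y :
  is_interval J -> (forall z, J z -> {for z, continuous f}) ->
  (forall z, J z -> f z != 0) -> J x -> J y -> (0 < f x) = (0 < f y).
Proof.
move=> iJ cf f0; wlog xy : x y / x <= y.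
  move=> H Jx Jy; case: (leP x y) => [|/ltW] xy; first exact: H.
  by apply/esym; exact: H.
move=> Jx Jy; have cw : {within `[x, y], continuous f}.
  apply: continuous_in_subspaceT => z; rewrite inE /= in_itv /= => xzy.
  by apply: cf; apply: iJ xzy.
apply/eqP/negPn/negP => ne.
have [|z zxy /eqP fz0] := IVT xy cw (v := 0).
  rewrite ge_min le_max; have := f0 x Jx; have := f0 y Jy; move: ne.
  by case: (ltgtP (f x) 0); case: (ltgtP (f y) 0).
by move: fz0; apply/negP/f0; move: zxy; rewrite in_itv /=; exact: iJ.
Qed.

Lemma is_derive_cst_interval (R : realType) (J : set R) (f : R -> R) x y :
  is_interval J -> (forall z, J z -> is_derive z 1 f 0) ->
  J x -> J y -> f x = f y.
Proof.
move=> iJ Df; wlog xy : x y / x <= y.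
  move=> H Jx Jy; case: (leP x y) => [|/ltW] xy; first exact: H.
  by apply/esym; exact: H.
move=> Jx Jy; have Jz z : z \in `[x, y] -> J z by rewrite in_itv /=; exact: iJ.
have [z /subset_itv_oo_cc/Jz/Df //||z _] := @MVT_segment _ f (fun=> 0) _ _ xy.
  apply: continuous_in_subspaceT => z /[!inE]/= /Jz/Df.
  exact: is_derive1_continuous.
by rewrite mul0r => /eqP; rewrite subr_eq0 => /eqP.
Qed.

(* The profile of a helical surface of pitch 1. In the orthonormal polar frame
   r^2 times the Hessian is [[L - s, -1], [-1, s]] with s = r F' and
   L = r s'; its eigenvalues are k and a k iff L = (1 + a) k and
   s (L - s) - 1 = a k^2, that is, (a k - s) (s - k) = 1. *)
Section Profile.
Variables (R : realType) (a : R) (J A : set R) (F dF d2F d3F : R -> R).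
Hypothesis JA : J `<=` A.
Hypotheses (iJ : is_interval J) (nJ : nondegenerate J).
Hypothesis J_gt0 : forall x, J x -> 0 < x.
Hypotheses (DF : forall x, A x -> is_derive x 1 F (dF x)).
Hypotheses (DdF : forall x, A x -> is_derive x 1 dF (d2F x)).
Hypotheses (Dd2F : forall x, A x -> is_derive x 1 d2F (d3F x)).
Hypothesis cd3F : forall x, A x -> {for x, continuous d3F}.
Hypothesis aN1 : a != -1.

(** With [dF] for F', [slope], [trace_fun] and [kappa] are s, L and k; [tau] is t = a k - s, which
    will be the tangent of the parameter u of [r_a]. *)
Definition slope x := x * dF x.
Definition trace_fun x := x * dF x + x * x * d2F x.
Definition kappa x := trace_fun x / (1 + a).
Definition tau x := a * kappa x - slope x.

Hypothesis ode : forall x, J x ->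
  slope x * (trace_fun x - slope x) - 1 = a * kappa x ^+ 2.

Let a1 : 1 + a != 0. Proof. by rewrite addrC -[1]opprK subr_eq0. Qed.

Lemma tauE x : J x -> tau x * (slope x - kappa x) = 1.
Proof.
move=> /ode o; have : trace_fun x = (1 + a) * kappa x.
  by rewrite /kappa; field.
rewrite /tau => E; rewrite E in o.
by rewrite -[1](subrK (a * kappa x ^+ 2)) -{2}o; ring.
Qed.

Lemma tau_neq0 x : J x -> tau x != 0.
Proof.
by move=> /tauE E; apply/eqP => t0; move: E; rewrite t0 mul0r => /eqP;
  rewrite eq_sym oner_eq0.
Qed.

(** By [tauE] the inverse of t is s - k, so s and k are recovered linearly from t = a k - s and 1 /
    t = s - k. *)
Lemma tau_slope x : J x -> (a - 1) * slope x = tau x + a / tau x.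
Proof.
move=> Jx; have -> : (tau x)^-1 = slope x - kappa x.
  by rewrite -[RHS](mulKf (tau_neq0 Jx)) tauE// mulr1.
by rewrite /tau; ring.
Qed.

Lemma tau_kappa x : J x -> (a - 1) * kappa x = tau x + (tau x)^-1.
Proof.
move=> Jx; have -> : (tau x)^-1 = slope x - kappa x.
  by rewrite -[RHS](mulKf (tau_neq0 Jx)) tauE// mulr1.
by rewrite /tau; ring.
Qed.

(** These derivatives are available on all of [A], whereas [ode] holds on [J] only; they make [tau]
    continuously differentiable up to the ends of [J]. *)
Let dslope x := dF x + x * d2F x.
Let dtau x := a / (1 + a) * (dslope x + (x + x) * d2F x + x * x * d3F x)
  - dslope x.

Let Did (x : R) : is_derive x (1 : R) (fun y : R => y) 1.
Proof. exact: is_derive_id. Qed.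

Lemma is_derive_slope x : A x -> is_derive x 1 slope (dslope x).
Proof.
move=> Ax; apply: (is_derive_eq (is_derive_mul (Did x) (DdF Ax))).
by rewrite /dslope; ring.
Qed.

Lemma is_derive_tau x : A x -> is_derive x 1 tau (dtau x).
Proof.
move=> Ax.
have D1 := is_derive_add (is_derive_mul (Did x) (DdF Ax))
  (is_derive_mul (is_derive_mul (Did x) (Did x)) (Dd2F Ax)).
have D2 := is_derive_mul D1 (is_derive_cst (1 + a)^-1 x 1).
have D3 := is_derive_mul (is_derive_cst a x 1) D2.
apply: (is_derive_eq (is_deriveB D3 (is_derive_slope Ax))).
by rewrite /dtau /dslope /cst /=; ring.
Qed.

Lemma tau_continuous x : A x -> {for x, continuous tau}.
Proof. by move=> Ax; apply: is_derive1_continuous (is_derive_tau Ax). Qed.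

Let cdtau x : A x -> {for x, continuous dtau}.
Proof.
move=> Ax; have c1 := is_derive1_continuous (DdF Ax).
have c2 := is_derive1_continuous (Dd2F Ax).
have c3 := cd3F Ax; have ci : {for x, continuous (fun y : R => y)} by exact: cvg_id.
have cs : {for x, continuous dslope} by apply: continuousD => //; exact: continuousM.
apply: continuousB => //; apply: continuousM; first exact: cvg_cst.
apply: continuousD; last by apply: continuousM => //; exact: continuousM.
by apply: continuousD => //; apply: continuousM => //; exact: continuousD.
Qed.

(** Differentiate (a - 1) s = t + a / t and insert r s' = (1 + a) k and (a - 1) k = t + 1 / t. The
    first relation can be differentiated only in the interior of [J]; continuity then carries the
    result to the ends. *)
Lemma tau_ode x : J x ->
  x * dtau x * (tau x ^+ 2 - a) = (1 + a) * tau x * (tau x ^+ 2 + 1).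
Proof.
move=> Jx; have Ax := JA Jx; have ct := tau_continuous Ax.
have ci : {for x, continuous (fun y : R => y)} by exact: cvg_id.
have cc (c : R) : {for x, continuous (fun _ : R => c)} by exact: cvg_cst.
have ct2 : {for x, continuous (fun y => tau y ^+ 2)}.
  exact: (continuousM ct ct).
apply: (@eq_continuous_closure R R
  (fun x : R => x * dtau x * (tau x ^+ 2 - a))
  (fun x : R => (1 + a) * tau x * (tau x ^+ 2 + 1)) J° x).
- apply: continuousM; last exact: continuousB.
  by apply: continuousM => //; exact: cdtau.
- by apply: continuousM; [exact: continuousM|exact: continuousD].
- exact: interval_closure_interior.
move=> y Jy; have Jyy := interior_subset Jy.
have t0 := tau_neq0 Jyy; have y0 := J_gt0 Jyy.
have D1 := is_derive_mul (is_derive_cst (a - 1) y 1) (is_derive_slope (JA Jyy)).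
have Dt := is_derive_tau (JA Jyy).
have D2 := is_derive_add Dt (is_derive_mul (is_derive_cst a y 1) (is_derive_inv t0 Dt)).
have nE : \near y, (a - 1) * slope y = tau y + a * (tau y)^-1.
  by apply: filterS Jy => z; exact: tau_slope.
have [_] := near_eq_is_derive nE D1; have [_ ->] := D2.
rewrite /cst !mulr0 !addr0 => E.
have Ls : y * dslope y = (1 + a) * kappa y.
  by rewrite /dslope /kappa /trace_fun; field.
have E2 := tau_kappa Jyy.
transitivity (tau y ^+ 2 * y * ((a - 1) * dslope y)).
  by rewrite -E; field.
transitivity (tau y ^+ 2 * (1 + a) * ((a - 1) * kappa y)).
  by rewrite -!mulrA [y * _]mulrCA Ls; ring.
by rewrite E2; field.
Qed.

(** If t^2 = a, the left-hand side of [tau_ode] vanishes, but no factor of the right-hand side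
    does. *)
Lemma tau2_neq x : J x -> tau x ^+ 2 - a != 0.
Proof.
move=> Jx; apply/eqP => E; have := tau_ode Jx; rewrite E mulr0 => /esym/eqP.
rewrite !mulf_eq0 (negbTE a1) (negbTE (tau_neq0 Jx)) /=; apply/negP.
by rewrite gt_eqF// ltr_wpDl// sqr_ge0.
Qed.

Lemma dtauE x : J x ->
  dtau x = (1 + a) * tau x * (tau x ^+ 2 + 1) / (x * (tau x ^+ 2 - a)).
Proof.
move=> Jx; have t2 := tau2_neq Jx; have x0 : x != 0 by rewrite gt_eqF// J_gt0.
by rewrite -tau_ode//; field; rewrite t2.
Qed.

Hypothesis tau_gt0 : forall x, J x -> 0 < tau x.

(** With t = tan u the conserved quantity is (a + 1) log r + log (cos u sin^a u), since log cos u =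
    - log (1 + t^2) / 2 and log sin u = log t - log (1 + t^2) / 2. *)
Lemma profile_radius x y : J x -> J y ->
  (a + 1) * ln x - (a + 1) / 2 * ln (1 + tau x ^+ 2) + a * ln (tau x) =
  (a + 1) * ln y - (a + 1) / 2 * ln (1 + tau y ^+ 2) + a * ln (tau y).
Proof.
move=> Jx Jy; apply: (@is_derive_cst_interval R J (fun x =>
  (a + 1) * ln x - (a + 1) / 2 * ln (1 + tau x ^+ 2) + a * ln (tau x)) x y)
  => [//|z Jz|//|//].
have t0 := tau_gt0 Jz; have z0 := J_gt0 Jz.
have Dt := is_derive_tau (JA Jz).
have q0 : 0 < 1 + tau z * tau z by rewrite ltr_wpDr// -expr2 sqr_ge0.
have D1 := is_derive_mul (is_derive_cst (a + 1) z 1) (is_derive1_ln z0).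
have D2 := @is_derive_comp R R (@ln R) (fun y => 1 + tau y * tau y) z 1 _ _
  (is_derive1_ln q0)
  (is_derive_add (is_derive_cst (1 : R) z 1) (is_derive_mul Dt Dt)).
have D3 := is_derive_mul (is_derive_cst ((a + 1) / 2) z 1) D2.
have D4 := is_derive_mul (is_derive_cst a z 1)
  (is_derive_comp (is_derive1_ln t0) Dt).
under eq_fun do rewrite expr2.
apply: (is_derive_eq (is_derive_add (is_deriveB D1 D3) D4)).
rewrite /cst dtauE//; field.
by rewrite tau2_neq// !gt_eqF.
Qed.

(** The derivative vanishes once F' is taken from [tau_slope] and t' from [dtauE]. Thus F is, up to
    a constant, the height of [r_a] at u = atan t. *)
Lemma profile_height x y : J x -> J y -> a - 1 != 0 ->
  F x - atan (tau x) - tau x / (a ^+ 2 - 1) - a ^+ 2 / (a ^+ 2 - 1) / tau x =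
  F y - atan (tau y) - tau y / (a ^+ 2 - 1) - a ^+ 2 / (a ^+ 2 - 1) / tau y.
Proof.
move=> Jx Jy am1; apply: (@is_derive_cst_interval R J (fun x =>
  F x - atan (tau x) - tau x / (a ^+ 2 - 1)
    - a ^+ 2 / (a ^+ 2 - 1) / tau x) x y) => [//|z Jz|//|//].
have t0 := tau_gt0 Jz; have z0 := J_gt0 Jz.
have Dt := is_derive_tau (JA Jz).
have D1 := is_derive_comp (is_derive1_atan (tau z)) Dt.
have D2 := is_derive_mul Dt (is_derive_cst (a ^+ 2 - 1)^-1 z 1).
have D3 := is_derive_mul (is_derive_cst (a ^+ 2 / (a ^+ 2 - 1)) z 1)
  (is_derive_inv (tau_neq0 Jz) Dt).
apply: (is_derive_eq (is_deriveB (is_deriveB (is_deriveB (DF (JA Jz)) D1) D2) D3)).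
have dFE : dF z = (tau z + a / tau z) / ((a - 1) * z).
  by rewrite -tau_slope// /slope; field; rewrite gt_eqF.
rewrite /cst dFE dtauE//; field.
have a21 : a ^+ 2 - 1 != 0 by rewrite subr_sqr_1 mulf_neq0// addrC.
by rewrite tau2_neq// a21 am1 !gt_eqF//= ltr_wpDr// sqr_ge0.
Qed.

End Profile.

(** * Polar coordinates and helices *)

Section Points.
Variable R : realType.
Implicit Types (p q : 'rV[R]_3) (x y z t : R).

Definition pt2 x y : 'rV[R]_2 := \row_(i < 2) nth 0 [:: x; y] i.

Lemma pt3_0 x y z : pt3 x y z 0 0 = x. Proof. by rewrite mxE. Qed.
Lemma pt3_1 x y z : pt3 x y z 0 1 = y. Proof. by rewrite mxE. Qed.
Lemma pt3_2 x y z : pt3 x y z 0 2 = z. Proof. by rewrite mxE. Qed.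
Lemma pt2_0 x y : pt2 x y 0 0 = x. Proof. by rewrite mxE. Qed.
Lemma pt2_1 x y : pt2 x y 0 1 = y. Proof. by rewrite mxE. Qed.
Lemma xy_0 p : xy p 0 0 = p 0 0. Proof. by rewrite mxE. Qed.
Lemma xy_1 p : xy p 0 1 = p 0 1. Proof. by rewrite mxE. Qed.
Definition ptE := (pt3_0, pt3_1, pt3_2, pt2_0, pt2_1, xy_0, xy_1).

Lemma ord2P (i : 'I_2) : i = 0 \/ i = 1.
Proof.
by case: i => [[|[|i]] hi] //; [left|right]; apply/val_inj.
Qed.

Lemma ord3P (i : 'I_3) : [\/ i = 0, i = 1 | i = 2].
Proof.
by case: i => [[|[|[|i]]] hi] //; [apply: Or31|apply: Or32|apply: Or33];
  apply/val_inj.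
Qed.

Lemma pt3_eq p q : p 0 0 = q 0 0 -> p 0 1 = q 0 1 -> p 0 2 = q 0 2 -> p = q.
Proof. by move=> e0 e1 e2; apply/rowP => i; case: (ord3P i) => ->. Qed.

Lemma pt2_eq (u v : 'rV[R]_2) : u 0 0 = v 0 0 -> u 0 1 = v 0 1 -> u = v.
Proof. by move=> e0 e1; apply/rowP => i; case: (ord2P i) => ->. Qed.

Lemma xy_pt3 x y z : xy (pt3 x y z) = pt2 x y.
Proof. by apply: pt2_eq; rewrite !ptE. Qed.

Lemma continuous_ext (T U : topologicalType) (f g : T -> U) (t : T) :
  f =1 g -> {for t, continuous f} -> {for t, continuous g}.
Proof. by move=> /funext ->. Qed.

Lemma nbhs_preimage (T U : topologicalType) (f : T -> U) (t : T) (B : set U) :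
  {for t, continuous f} -> open B -> B (f t) -> nbhs t (f @^-1` B).
Proof. by move=> cf oB Bt; apply: cf; exact: open_nbhs_nbhs. Qed.

Lemma row_continuous (T : topologicalType) n (f : T -> 'rV[R]_n) (t : T) :
  (forall i, {for t, continuous (fun s => f s 0 i)}) -> {for t, continuous f}.
Proof.
move=> cf B [P nP PB]; rewrite nbhs_filterE /= /fmap /=.
apply: (@filterS _ _ _ [set s | forall j, P 0 j (f s 0 j)]).
  by move=> s Ps; apply: PB => i j; rewrite ord1; exact: Ps.
apply: filter_forall => j; exact: cf (nP 0 j).
Qed.

Lemma pt3_continuous (T : topologicalType) (f g k : T -> R) (t : T) :
  {for t, continuous f} -> {for t, continuous g} -> {for t, continuous k} ->
  {for t, continuous (fun s => pt3 (f s) (g s) (k s))}.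
Proof.
move=> cf cg ck; apply: row_continuous => i.
by case: (ord3P i) => ->; [apply: continuous_ext cf|apply: continuous_ext cg|
  apply: continuous_ext ck] => s; rewrite !ptE.
Qed.

End Points.

Section Polar.
Variable R : realType.
Implicit Types (p q : 'rV[R]_3) (x y z h phi psi : R).

Lemma atan_polar x y : 0 < x ->
  x = Num.sqrt (x * x + y * y) * cos (atan (y / x)) /\
  y = Num.sqrt (x * x + y * y) * sin (atan (y / x)).
Proof.
move=> x0; have q0 : 0 < x * x + y * y.
  by rewrite ltr_pwDl ?mulr_gt0// -expr2 sqr_ge0.
have r0 : 0 < Num.sqrt (x * x + y * y) by rewrite sqrtr_gt0.
have cE : cos (atan (y / x)) = x / Num.sqrt (x * x + y * y).
  rewrite cos_atan; have -> : 1 + (y / x) ^+ 2 = (x * x + y * y) / x ^+ 2.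
    by field; rewrite gt_eqF.
  rewrite sqrtrM ?(ltW q0)// sqrtrV ?exprn_ge0 ?(ltW x0)// sqrtr_sqr gtr0_norm//.
  by rewrite invfM invrK mulrC.
have sE : sin (atan (y / x)) = y / Num.sqrt (x * x + y * y).
  have := atanK (y / x); rewrite /tan cE => /(canRL (divfK _)) -> //.
    by field; rewrite !gt_eqF.
  by rewrite mulf_neq0 ?invr_neq0 ?gt_eqF.
by rewrite cE sE; split; field; rewrite gt_eqF.
Qed.

Lemma polar_exists x y : 0 < x * x + y * y -> exists psi,
  x = Num.sqrt (x * x + y * y) * cos psi /\
  y = Num.sqrt (x * x + y * y) * sin psi.
Proof.
move=> q0; have r0 : 0 < Num.sqrt (x * x + y * y) by rewrite sqrtr_gt0.
have [x0|x0|x0] := ltgtP x 0; last 1 first.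
- move: q0; rewrite x0 mul0r add0r => q0; have y0 : y != 0.
    by apply: contraTneq q0 => ->; rewrite mul0r ltxx.
  have [y1|y1] := leP 0 y; [exists (pi / 2)|exists (- (pi / 2))].
    by rewrite -expr2 sqrtr_sqr ger0_norm// cos_pihalf sin_pihalf mulr0 mulr1.
  rewrite -expr2 sqrtr_sqr ltr0_norm// cosN sinN cos_pihalf sin_pihalf mulr0.
  by rewrite mulrNN mulr1.
- have [] := @atan_polar (- x) (- y); first by rewrite oppr_gt0.
  rewrite !mulrNN => ex ey; exists (atan (- y / - x) + pi).
  by rewrite cosDpi sinDpi !mulrN -ex -ey !opprK.
- by exists (atan (y / x)); exact: atan_polar.
Qed.

Definition rad p := Num.sqrt (p 0 0 * p 0 0 + p 0 1 * p 0 1).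

Lemma rad_continuous p : {for p, continuous rad}.
Proof.
apply: continuous_comp; last exact: sqrt_continuous.
by apply: continuousD; apply: continuousM; exact: coord_continuous.
Qed.

Lemma sqrt_cos_sin x psi : 0 <= x ->
  Num.sqrt (x * cos psi * (x * cos psi) + x * sin psi * (x * sin psi)) = x.
Proof.
move=> x0; rewrite (_ : _ + _ = x ^+ 2); first by rewrite sqrtr_sqr ger0_norm.
by rewrite -[RHS]mulr1 -(cos2Dsin2 psi); ring.
Qed.

Definition helix h x z psi := pt3 (x * cos psi) (x * sin psi) (z + h * psi).

Lemma rad_helix h x z psi : 0 <= x -> rad (helix h x z psi) = x.
Proof. by move=> x0; rewrite /rad !ptE sqrt_cos_sin. Qed.

Lemma helical_motion_helix h x z psi phi :
  helical_motion h phi (helix h x z psi) = helix h x z (phi + psi).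
Proof.
by apply: pt3_eq; rewrite !ptE ?cosD ?sinD; ring.
Qed.

Lemma helix0 h x z : helix h x z 0 = pt3 x 0 z.
Proof. by apply: pt3_eq; rewrite !ptE ?cos0 ?sin0; ring. Qed.

Lemma helical_motion_continuous h phi : continuous (@helical_motion R h phi).
Proof.
move=> p; have c i : {for p, continuous (fun q : 'rV[R]_3 => q 0 i)}.
  exact: coord_continuous.
have cc (b : R) : {for p, continuous (fun _ : 'rV[R]_3 => b)} by apply: cst_continuous.
apply: (@pt3_continuous R _ (fun p => cos phi * p 0 0 - sin phi * p 0 1)
  (fun p => sin phi * p 0 0 + cos phi * p 0 1) (fun p => p 0 2 + h * phi)).
- by apply: continuousB; apply: continuousM.
- by apply: continuousD; apply: continuousM.
- exact: continuousD.
Qed.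

End Polar.

(* A continuous injection of a triangle into the line is impossible: the value
   at the vertex in the middle is taken again on the opposite side. *)
Section Segment.
Variables (R : realType) (V : normedModType R) (D : set V) (g : V -> R).
Hypothesis cD : forall u v (t : R), D u -> D v -> 0 <= t <= 1 -> D (u + t *: (v - u)).
Hypothesis cg : forall u, D u -> {for u, continuous g}.

Lemma IVT_segment u v c : D u -> D v -> g u <= c <= g v \/ g v <= c <= g u ->
  exists2 t, 0 <= t <= 1 & g (u + t *: (v - u)) = c.
Proof.
move=> Du Dv guv; pose k t := g (u + t *: (v - u)).
have ck : {within `[0, 1], continuous k}.
  apply: continuous_in_subspaceT => t; rewrite inE /= in_itv /= => t01.
  apply: continuous_comp; last by apply: cg; exact: cD.
  apply: continuousD; first exact: cvg_cst.
  by apply: continuousZr_tmp; exact: cvg_id.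
have [|t t01 <-] := IVT ler01 ck (v := c).
  rewrite /k scale0r addr0 scale1r subrKC.
  rewrite ge_min le_max.
  by case: guv => /andP[-> ->]; rewrite ?orbT.
by exists t; rewrite // -[_ <= _ <= _]/(t \in `[0, 1]).
Qed.

Lemma triangle_not_injective (u v w : V) : D u -> D v -> D w ->
  {in D &, injective g} ->
  (forall t, u + t *: (v - u) != w) -> (forall t, u + t *: (w - u) != v) ->
  (forall t, v + t *: (w - v) != u) -> False.
Proof.
move=> Du Dv Dw inj nw nv nu.
have H u1 v1 w1 : D u1 -> D v1 -> D w1 -> (forall t, u1 + t *: (v1 - u1) != w1) ->
    g u1 <= g w1 <= g v1 \/ g v1 <= g w1 <= g u1 -> False.
  move=> D1 D2 D3 ne /(IVT_segment D1 D2)[t t01 e].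
  move/eqP: (ne t); apply; apply: inj => //; rewrite inE//; exact: cD.
have [uv|/ltW uv] := leP (g u) (g v); have [uw|/ltW uw] := leP (g u) (g w);
  have [vw|/ltW vw] := leP (g v) (g w).
- by apply: (H u w v) => //; left; rewrite uv.
- by apply: (H u v w) => //; left; rewrite uw.
- by apply: (H u w v) => //; left; rewrite uv.
- by apply: (H v w u) => //; right; rewrite uw.
- by apply: (H v w u) => //; left; rewrite uv.
- by apply: (H v w u) => //; left; rewrite uv.
- by apply: (H u v w) => //; right; rewrite vw.
- by apply: (H u w v) => //; right; rewrite vw.
Qed.

End Segment.

(** * Local structure of a helical surface *)

Section LocalProfile.
Variable R : realType.
Implicit Types (p q : 'rV[R]_3) (h r w x phi : R) (S U : set 'rV[R]_3).

Lemma helical_closed h S p phi : helical h S -> S p -> S (helical_motion h phi p).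
Proof. by move=> hel Sp; rewrite -(hel phi); exists p. Qed.

Definition angle q := atan (q 0 1 / q 0 0).

(** The point at which the helix of pitch [h] through [q] meets the half-plane y = 0, x > 0. *)
Definition meridian h q := pt3 (rad q) 0 (q 0 2 - h * angle q).

Lemma helix_angle h q : 0 < q 0 0 ->
  q = helix h (rad q) (q 0 2 - h * angle q) (angle q).
Proof.
move=> q0; have [ex ey] := atan_polar (q 0 1) q0.
by apply: pt3_eq; rewrite !ptE -/(rad q) -/(angle q) // subrK.
Qed.

Lemma helical_motion_meridian h q : 0 < q 0 0 ->
  helical_motion h (- angle q) q = meridian h q.
Proof.
move=> q0; rewrite {2}(helix_angle h q0) helical_motion_helix.
by rewrite addNr helix0.
Qed.

Lemma angle_continuous q : 0 < q 0 0 -> {for q, continuous angle}.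
Proof.
move=> q0; apply: continuous_comp; last exact: continuous_atan.
apply: continuousM; first exact: coord_continuous.
by apply: continuousV; [rewrite gt_eqF|exact: coord_continuous].
Qed.

Lemma meridian_continuous h q : 0 < q 0 0 -> {for q, continuous (meridian h)}.
Proof.
move=> q0; apply: pt3_continuous; first exact: rad_continuous.
  exact: cst_continuous.
apply: continuousB; first exact: coord_continuous.
by apply: continuousM; [exact: cst_continuous|exact: angle_continuous].
Qed.

Lemma pt2_continuous (T : topologicalType) (f g : T -> R) (t : T) :
  {for t, continuous f} -> {for t, continuous g} ->
  {for t, continuous (fun s => pt2 (f s) (g s))}.
Proof.
move=> cf cg; apply: row_continuous => i.
by case: (ord2P i) => ->; [apply: continuous_ext cf|apply: continuous_ext cg]
  => s; rewrite !ptE.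
Qed.

Lemma Ck1_slice k (W : set 'rV[R]_2) (f : 'rV[R]_2 -> R) :
  open W -> Ck (delta_row 2) k W f ->
  Ck1 k [set x | W (pt2 x 0)] (fun x => f (pt2 x 0)).
Proof.
move=> oW; have oA : open [set x | W (pt2 x 0)].
  apply: (@open_comp _ _ (fun x : R => pt2 x 0)) oW => x _.
  by apply: pt2_continuous; [exact: cvg_id|exact: cst_continuous].
elim: k f => [|k IH] f Cf.
  split=> // x Wx; apply: continuous_comp; last exact: Ck_continuous Cf Wx.
  by apply: pt2_continuous; [exact: cvg_id|exact: cst_continuous].
apply: (@Ck1_intro _ _ _ _ (fun x => 'D_(delta_mx 0 0) f (pt2 x 0))) => //.
  move=> x Wx; have /is_derive_lineE := Ck_is_derive (0 : 'I_2) Cf Wx.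
  move=> Df; apply/is_derive_lineE; move: Df; congr is_derive.
  apply/funext => t; congr f.
  by apply: pt2_eq; rewrite !mxE /= ?[_%:A]mulr1 ?mulr1 ?mulr0 ?addr0.
exact: (IH (fun v => 'D_(delta_mx 0 0) f v) (Cf.2 0).2).
Qed.

Lemma ltr_convex (y z c t : R) :
  y < c -> z < c -> 0 <= t <= 1 -> y + t * (z - y) < c.
Proof. by move=> yc zc /andP[t0 t1]; case: (leP y z) => yz; nra. Qed.

(** A helical motion brings each nearby point to its meridian point, where S is the graph of [f];
    hence F is the restriction of [f] to the x-axis. J is the set of radii of a convex piece of a
    chart, so it is an interval. *)
Lemma local_profile S h r w f : helical h S -> 0 < r -> S (pt3 r 0 w) ->
  (exists U V Phi Psi, straightening_chart S (pt3 r 0 w) U V Phi Psi) ->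
  local_graph S (pt3 r 0 w) f ->
  exists (F : R -> R) (U : set 'rV[R]_3) (J A : set R),
  [/\ open U, U (pt3 r 0 w) & forall q, S q -> U q ->
       [/\ 0 < q 0 0, J (rad q) & q 0 2 = F (rad q) + h * angle q]] /\
  [/\ forall x, J x -> exists q, [/\ S q, U q & rad q = x],
      is_interval J, nondegenerate J & forall x, J x -> 0 < x] /\
  [/\ open A, J `<=` A & Ck1 3 A F].
Proof.
move=> hel r0 Sp [Uc [Vc [Phi [Psi [Up
  [[oUc oVc CPhi CPsi] [UV VU PsiPhi PhiPsi]] img]]]]].
move=> [[W [oW Wp CW]] [U0 [oU0 U0p fE]]]; pose F x := f (pt2 x 0).
set p := pt3 r 0 w in Sp Up Wp U0p *.
have p00 : p 0 0 = r by rewrite ptE.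
have radp : rad p = r.
  by rewrite /rad !ptE mul0r addr0 -expr2 sqrtr_sqr gtr0_norm.
have angp : angle p = 0 by rewrite /angle !ptE mul0r atan0.
pose A := [set x | W (pt2 x 0)].
have cpt (x : R) : {for x, continuous (fun x : R => pt2 x 0)}.
  by apply: pt2_continuous; [exact: cvg_id|exact: cst_continuous].
have oA : open A.
  by apply: (@open_comp _ _ (fun x : R => pt2 x 0)) oW => x _; exact: cpt.
(* On this open set the meridian point stays where S is the graph of [f], so the height is F(r) + h
   times the angle. *)
pose good := [set q : 'rV[R]_3 | [/\ 0 < q 0 0, U0 (meridian h q) & A (rad q)]].
have ogood : open good.
  rewrite openE => q [q0 Uq Aq]; have c0 : {for q, continuous (fun q : 'rV[R]_3 => q 0 0)}.
    exact: coord_continuous.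
  have n1 : nbhs q [set q' : 'rV[R]_3 | 0 < q' 0 0].
    exact: (nbhs_preimage c0 (@open_gt _ (0 : R)) q0).
  have n2 : nbhs q [set q' | U0 (meridian h q')].
    exact: (nbhs_preimage (@meridian_continuous h q q0) oU0 Uq).
  have n3 : nbhs q [set q' | A (rad q')].
    exact: (nbhs_preimage (@rad_continuous R q) oA Aq).
  by apply: filterS (filterI n1 (filterI n2 n3)) => q' [? []].
have gp : good p.
  split; rewrite ?p00 ?radp//; last by rewrite /A /=; move: Wp; rewrite xy_pt3.
  by rewrite /meridian radp angp mulr0 subr0 ptE.
have goodE q : S q -> good q -> q 0 2 = F (rad q) + h * angle q.
  move=> Sq [q0 Uq Aq]; have := helical_closed (- angle q) hel Sq.
  rewrite helical_motion_meridian// => /fE/(_ Uq).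
  by rewrite xy_pt3 ptE /F => <-; rewrite subrK.
have cPhi q : Uc q -> {for q, continuous Phi} by move=> Uq; exact: CPhi.1.
have cPsi y : Vc y -> {for y, continuous Psi} by move=> Vy; exact: CPsi.1.
have Vp : Vc (Phi p) by exact: UV.
have PPp : Psi (Phi p) = p by exact: PsiPhi.
have : nbhs (Phi p) (Vc `&` Psi @^-1` good).
  apply: filterI; first exact: open_nbhs_nbhs.
  by apply: (nbhs_preimage (cPsi _ Vp) ogood); rewrite PPp.
move=> /nbhs_ballP[e /= e0 eb].
(* The ball is so small that [Psi] sends it into [good]. Its part [D] in the half-plane is convex
   and parametrizes S within [U]. *)
pose D := [set y : 'rV[R]_3 | [/\ ball (Phi p) e y, 0 <= y 0 0 & y 0 2 = 0]].
have imD y : Vc y -> 0 <= y 0 0 -> y 0 2 = 0 -> S (Psi y) /\ Uc (Psi y).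
  move=> Vy y0 y2; have : (Phi @` (S `&` Uc)) y by rewrite img.
  by move=> [q [Sq Uq] <-]; rewrite PsiPhi.
have HPp : 0 <= (Phi p) 0 0 /\ (Phi p) 0 2 = 0.
  have : (Phi @` (S `&` Uc)) (Phi p) by exists p.
  by rewrite img => -[_ []].
have DPp : D (Phi p) by split; [exact: ballxx|case: HPp..].
have DV y : D y -> [/\ Vc y, good (Psi y), S (Psi y) & Uc (Psi y)].
  by move=> [/eb[Vy gy] y0 y2]; have [] := imD y Vy y0 y2.
pose U := [set q : 'rV[R]_3 | [/\ Uc q, good q & ball (Phi p) e (Phi q)]].
have oU : open U.
  rewrite openE => q [Uq gq bq].
  have n1 : nbhs q Uc by exact: open_nbhs_nbhs.
  have n2 : nbhs q good by exact: open_nbhs_nbhs.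
  have n3 : nbhs q (Phi @^-1` ball (Phi p) e).
    by apply: (nbhs_preimage (cPhi q Uq)) => //; exact: ball_open.
  by apply: filterS (filterI n1 (filterI n2 n3)) => q' [? []].
pose J := [set x | exists2 y, D y & rad (Psi y) = x].
have SUD q : S q -> U q -> D (Phi q).
  move=> Sq [Uq gq bq]; have : (Phi @` (S `&` Uc)) (Phi q) by exists q.
  by rewrite img => -[_ []].
have cD u v (t : R) : D u -> D v -> 0 <= t <= 1 -> D (u + t *: (v - u)).
  move=> [[_ bu] u0 u2] [[_ bv] v0 v2] t01; have /andP[t0 t1] := t01; split.
  - split=> // i j; move: (bu i j) (bv i j); rewrite /ball /= !mxE.
    rewrite !ltr_norml => /andP[u1 u1'] /andP[v1 v1']; rewrite ltrNl.
    have := ltr_convex u1' v1' t01; rewrite ltrNl in u1; rewrite ltrNl in v1.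
    have := ltr_convex u1 v1 t01 => h1 h2; apply/andP; split; lra.
  - by rewrite !mxE; nra.
  - by rewrite !mxE u2 v2; ring.
have cg (g : 'rV[R]_3 -> R) : (forall q, good q -> {for q, continuous g}) ->
    forall u, D u -> {for u, continuous (fun y => g (Psi y))}.
  move=> cg u Du; have [Vu gu _ _] := DV u Du.
  by apply: continuous_comp; [exact: cPsi|exact: cg].
have iJ : is_interval J.
  move=> _ _ [u Du <-] [v Dv <-] x uxv.
  have cr := cg _ (fun q _ => @rad_continuous R q).
  have [t t01 <-] := IVT_segment cD cr Du Dv (or_introl uxv).
  by exists (u + t *: (v - u)) => //; exact: cD.
exists F, U, J, A; split; first split=> //.
- by split=> //; exact: ballxx.
- move=> q Sq Uq; have [Uq' gq _] := Uq; split; first by case: gq.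
    by exists (Phi q); [exact: SUD|rewrite PsiPhi].
  exact: goodE.
split; last split=> //.
- split=> //.
  + move=> _ [y Dy <-]; have [Vy gy Sy Uy] := DV y Dy.
    exists (Psi y); split=> //; split=> //.
    by rewrite PhiPsi//; case: Dy.
  (* If r were the only radius, [Psi] would send [D] into a single helix, and the polar angle would
     be a continuous injection of [D] into the line, against [triangle_not_injective]. *)
  + apply: contrapT => nJ.
    have Jr x : J x -> x = r.
      have Jr : J r by exists (Phi p); rewrite ?PPp.
      by move=> Jx; case: (ltgtP x r) => // xr; case: nJ; [exists x, r|exists r, x].
    pose g y := angle (Psi y).
    have gi : {in D &, injective g}.
      move=> y z /[!inE] Dy Dz gyz.
      have [Vy gy Sy Uy] := DV y Dy; have [Vz gz Sz Uz] := DV z Dz.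
      rewrite -(PhiPsi _ Vy) -(PhiPsi _ Vz); congr Phi.
      have [y0 _ _] := gy; have [z0 _ _] := gz.
      rewrite (helix_angle h y0) (helix_angle h z0) !goodE// !addrK.
      have -> : rad (Psi y) = r by apply: Jr; exists y.
      have -> : rad (Psi z) = r by apply: Jr; exists z.
      by rewrite -/(g y) gyz.
    (* The vertices of the triangle are [Phi p] and its translates along the first two axes; the
       positive step along axis 0 stays in the half-plane also when [p] is a boundary point. *)
    pose d (i : 'I_3) : 'rV[R]_3 := Phi p + (e / 2) *: delta_mx 0 i.
    have Dd (i : 'I_3) : i != 2 -> D (d i).
      move=> i2; split; last 2 first.
      - by rewrite !mxE; case: HPp => p1 _; rewrite addr_ge0// mulr_ge0// ltW// divr_gt0.
      - by rewrite !mxE eq_sym (negbTE i2) mulr0 addr0; case: HPp.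
      split=> // k j; rewrite /ball /= !mxE opprD addNKr normrN normrM.
      rewrite gtr0_norm ?divr_gt0// (le_lt_trans (y := e / 2))//.
        case: (_ && _); rewrite ?normr1 ?normr0 ?mulr1 ?mulr0 ?lexx//.
        by rewrite divr_ge0 ?ltW.
      by rewrite ltr_pdivrMr// ltr_pMr// ltr1n.
    have e20 : e / 2 != 0 by rewrite mulf_neq0 ?invr_neq0// gt_eqF.
    apply: (@triangle_not_injective _ _ D g cD _ (Phi p) (d 0) (d 1)) => //.
    * by apply: cg => q [q0 _ _]; exact: angle_continuous.
    * exact: Dd.
    * exact: Dd.
    * move=> t; apply/eqP => /rowP/(_ 1) /eqP; rewrite !mxE /= !mulr0 !mulr1.
      by rewrite addr0 subrr mulr0 addr0 -subr_eq0 opprD addNKr oppr_eq0 (negbTE e20).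
    * move=> t; apply/eqP => /rowP/(_ 0) /eqP; rewrite !mxE /= !mulr0 !mulr1.
      by rewrite addr0 subrr mulr0 addr0 -subr_eq0 opprD addNKr oppr_eq0 (negbTE e20).
    * move=> t; apply/eqP => E.
      move/rowP/(_ 0): (E); move/rowP/(_ 1): E; rewrite !mxE /= => E1 E0.
      by move/eqP: e20; apply; lra.
  + move=> _ [y Dy <-]; have [Vy [y0 _ _] _ _] := DV y Dy.
    by rewrite sqrtr_gt0 ltr_pwDl ?mulr_gt0// -expr2 sqr_ge0.
- by move=> _ [y Dy <-]; have [_ [_ _ Ay] _ _] := DV y Dy.
- exact/Ck1_slice/Ck_onE.
Qed.

End LocalProfile.

(** * The Hessian of a helical function in coordinates changed by a plane similarity *)

Section ConformalHelical.
Variable R : realType.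

Definition affine (a b c : R) (v : 'rV[R]_2) : R := a * v 0 0 + b * v 0 1 + c.

Definition daffine (a b : R) (i : 'I_2) : R := a * (i == 0)%:R + b * (i == 1)%:R.

Lemma affine_continuous a b c : continuous (affine a b c).
Proof.
move=> v; have cc (k : R) : {for v, continuous (fun _ : 'rV[R]_2 => k)}.
  exact: cst_continuous.
have cv i : {for v, continuous (fun v : 'rV[R]_2 => v 0 i)}.
  exact: coord_continuous.
exact: (continuousD (continuousD (continuousM (cc a) (cv 0))
  (continuousM (cc b) (cv 1))) (cc c)).
Qed.

Lemma is_derive_affine a b c i v :
  is_derive v (delta_mx 0 i) (affine a b c) (daffine a b i).
Proof.
have D0 := is_derive_mul (is_derive_cst a v (delta_mx 0 i)) (is_derive_coord v i 0).
have D1 := is_derive_mul (is_derive_cst b v (delta_mx 0 i)) (is_derive_coord v i 1).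
have D2 := is_derive_cst c v (delta_mx 0 i).
apply: (is_derive_eq (is_derive_add (is_derive_add D0 D1) D2)).
by rewrite /daffine /cst; ring.
Qed.

Variables (s : bool) (A B c0 c1 : R).
Let sg : R := (-1) ^+ s.
Let X := affine (sg * A) (- (sg * B)) c0.
Let Y := affine B A c1.
Let nu := A ^+ 2 + B ^+ 2.
Local Notation r := (radius X Y).

(** In an orthonormal polar frame of the (X, Y)-plane the Hessian of F(r) + h theta is
    [[F'', - h / r^2], [- h / r^2, F' / r]]. The map (X, Y) is a similarity of ratio the square root
    of [nu], so the Hessian in the original coordinates is [nu] times an orthogonal conjugate of
    this matrix. *)
Lemma conformal_hessian F dF ddF h (dom : set R) v : open dom ->
  polar_dom X Y dom v -> (forall x, dom x -> is_derive x 1 F (dF x)) ->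
  is_derive (r v) 1 dF ddF ->
  let H := hessian (helical_fun X Y F h) v in
  H 0 0 + H 1 1 = nu * (ddF + dF (r v) / r v) /\
  H 0 0 * H 1 1 - H 0 1 * H 1 0 =
    nu ^+ 2 * (ddF * (dF (r v) / r v) - (h / r v ^+ 2) ^+ 2).
Proof.
move=> od Uv DF DdF H; have [X0 _] := Uv.
have r0 : 0 < r v by exact: radius_gt0.
pose c := X v / r v; pose d := Y v / r v.
have cd : c * c + d * d = 1.
  have := radius_sqr X Y v; rewrite /c /d => E.
  transitivity ((X v * X v + Y v * Y v) / (r v * r v)); first by field; rewrite gt_eqF.
  by rewrite -E divff// mulf_neq0 ?gt_eqF.
(* (c, d) is the radial unit vector and [n] the gradient of the radius in the original coordinates.
   All entries are expressed by [n], whose squared length is [nu]. *)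
pose n (i : 'I_2) := c * daffine (sg * A) (- (sg * B)) i + d * daffine B A i.
have sg2 : sg * sg = 1 by rewrite /sg -expr2 sqrr_sign.
have n0E : n 0 = sg * A * c + B * d by rewrite /n /daffine /=; ring.
have n1E : n 1 = A * d - sg * B * c by rewrite /n /daffine /=; ring.
have nuE : nu = n 0 ^+ 2 + n 1 ^+ 2.
  rewrite n0E n1E; transitivity (nu * (c * c + d * d)); first by rewrite cd mulr1.
  rewrite /nu; transitivity (A ^+ 2 * (sg * sg) * c ^+ 2 + B ^+ 2 * (sg * sg) * c ^+ 2
    + (A ^+ 2 + B ^+ 2) * d ^+ 2); first by rewrite sg2; ring.
  by ring.
have HE i j : H j i = ddF * (n i * n j)
    + (dF (r v) / r v) * (daffine (sg * A) (- (sg * B)) i * daffine (sg * A) (- (sg * B)) j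
        + daffine B A i * daffine B A j - n i * n j)
    + (h / r v ^+ 2) * (daffine (sg * A) (- (sg * B)) j * daffine B A i
        - daffine B A j * daffine (sg * A) (- (sg * B)) i
        - 2 * (c * daffine B A i - d * daffine (sg * A) (- (sg * B)) i) * n j).
  rewrite mxE (derive2_helical_fun (@affine_continuous _ _ _) (@affine_continuous _ _ _)
    (@is_derive_affine _ _ _) (@is_derive_affine _ _ _) h i j od Uv DF DdF).
  by rewrite -/X -/Y /n /c /d; field; rewrite gt_eqF.
set t1 := ddF; set t2 := dF (r v) / r v; set t3 := h / r v ^+ 2.
have nuE' : A * A + B * B = n 0 * n 0 + n 1 * n 1 by rewrite -!expr2.
have H00 : H 0 0 = t1 * (n 0 * n 0) + t2 * (n 1 * n 1) + 2 * sg * t3 * (n 0 * n 1).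
  rewrite HE /daffine /= -/t1 -/t2 -/t3.
  (* The intermediate forms here and below display [sg * sg], which has to be replaced by 1 between
     two uses of [ring]. *)
  transitivity (t1 * (n 0 * n 0) + t2 * (sg * sg * (A * A) + B * B - n 0 * n 0)
    + t3 * (2 * (d * (sg * A) - c * B) * n 0)); first by ring.
  rewrite sg2 mul1r nuE'; transitivity (t1 * (n 0 * n 0) + t2 * (n 1 * n 1)
    + t3 * (2 * (sg * (A * d) - (sg * sg) * B * c) * n 0)); first by rewrite sg2; ring.
  by rewrite n1E; ring.
have H11 : H 1 1 = t1 * (n 1 * n 1) + t2 * (n 0 * n 0) - 2 * sg * t3 * (n 0 * n 1).
  rewrite HE /daffine /= -/t1 -/t2 -/t3.
  transitivity (t1 * (n 1 * n 1) + t2 * (A * A + sg * sg * (B * B) - n 1 * n 1)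
    + t3 * (- 2 * (c * A + d * (sg * B)) * n 1)); first by ring.
  rewrite sg2 mul1r nuE'; transitivity (t1 * (n 1 * n 1) + t2 * (n 0 * n 0)
    - t3 * (2 * ((sg * sg) * A * c + sg * B * d) * n 1)); first by rewrite sg2; ring.
  by rewrite n0E; ring.
have H01 : H 0 1 = (t1 - t2) * (n 0 * n 1) + sg * t3 * (n 1 * n 1 - n 0 * n 0).
  rewrite HE /daffine /= -/t1 -/t2 -/t3.
  transitivity (t1 * (n 0 * n 1) + t2 * (- (sg * sg) * A * B + A * B - n 0 * n 1)
    + t3 * (sg * (A * A + B * B) - 2 * (c * A + d * (sg * B)) * n 0)); first by ring.
  rewrite sg2 nuE'; transitivity (t1 * (n 0 * n 1) - t2 * (n 0 * n 1)
    + t3 * (sg * (n 0 * n 0 + n 1 * n 1) - 2 * ((sg * sg) * A * c + sg * B * d) * n 0)).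
    by rewrite sg2; ring.
  by rewrite (_ : sg * sg * A * c + sg * B * d = sg * n 0); [ring|rewrite n0E; ring].
have H10 : H 1 0 = (t1 - t2) * (n 0 * n 1) + sg * t3 * (n 1 * n 1 - n 0 * n 0).
  rewrite HE /daffine /= -/t1 -/t2 -/t3.
  transitivity (t1 * (n 0 * n 1) + t2 * (- (sg * sg) * A * B + A * B - n 0 * n 1)
    + t3 * (2 * (d * (sg * A) - c * B) * n 1 - sg * (A * A + B * B))); first by ring.
  rewrite sg2 nuE'; transitivity (t1 * (n 0 * n 1) - t2 * (n 0 * n 1)
    + t3 * (2 * (sg * A * d - (sg * sg) * B * c) * n 1 - sg * (n 0 * n 0 + n 1 * n 1))).
    by rewrite sg2; ring.
  by rewrite (_ : sg * A * d - sg * sg * B * c = sg * n 1); [ring|rewrite n1E; ring].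
rewrite H00 H11 H01 H10 nuE; split; first by ring.
transitivity (t1 * t2 * (n 0 ^+ 2 + n 1 ^+ 2) ^+ 2
   - (sg * sg) * t3 ^+ 2 * (n 0 ^+ 2 + n 1 ^+ 2) ^+ 2); first by ring.
by rewrite sg2; ring.
Qed.

End ConformalHelical.

(** * The Hessian of an arbitrary local graph function of a helical surface *)

Section LocalStructure.
Variable R : realType.
Implicit Types (v : 'rV[R]_2) (p q : 'rV[R]_3) (h x theta : R) (S U : set 'rV[R]_3).

Lemma derive_addc (V : normedModType R) (f : V -> R) (c : R) (e : V) :
  (fun x : V => 'D_e (fun y => f y + c) x) = (fun x : V => 'D_e f x).
Proof.
apply/funext => x; rewrite /derive.
suff -> : (fun t : R => t^-1 *: (((fun y => f y + c) \o shift x) (t *: e) -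
    (f x + c))) = (fun t : R => t^-1 *: ((f \o shift x) (t *: e) - f x)) by [].
by apply/funext => t /=; rewrite opprD addrACA subrr addr0.
Qed.

(** The coordinates after rotation through [- theta], written literally as the [X] and [Y] of
    [conformal_hessian] with [s = false], [A = cos theta] and [B = - sin theta], so that this lemma
    applies as it stands. *)
Definition rotX theta := affine ((-1) ^+ false * cos theta)
  (- ((-1) ^+ false * - sin theta)) (0 : R).
Definition rotY theta := affine (- sin theta) (cos theta) (0 : R).

Lemma rotXE theta v : rotX theta v = cos theta * v 0 0 + sin theta * v 0 1.
Proof. by rewrite /rotX /affine expr0; ring. Qed.

Lemma rotYE theta v : rotY theta v = cos theta * v 0 1 - sin theta * v 0 0.
Proof. by rewrite /rotY /affine; ring. Qed.

Lemma radius_rot theta v : radius (rotX theta) (rotY theta) v =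
  Num.sqrt (v 0 0 * v 0 0 + v 0 1 * v 0 1).
Proof.
rewrite /radius rotXE rotYE; congr Num.sqrt.
by rewrite -[RHS]mul1r -(cos2Dsin2 theta); ring.
Qed.

Lemma rot_inv theta v :
  v 0 0 = cos theta * rotX theta v - sin theta * rotY theta v /\
  v 0 1 = sin theta * rotX theta v + cos theta * rotY theta v.
Proof.
have cs := cos2Dsin2 theta; rewrite rotXE rotYE; split.
  by rewrite -[LHS]mul1r -cs; ring.
by rewrite -[LHS]mul1r -cs; ring.
Qed.

Lemma rotX_scale theta c v : rotX theta (c *: v) = c * rotX theta v.
Proof. by rewrite !rotXE !mxE; ring. Qed.

Lemma helical_motionN h theta q :
  helical_motion h (- theta) q =
  pt3 (rotX theta (xy q)) (rotY theta (xy q)) (q 0 2 - h * theta).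
Proof.
by apply: pt3_eq; rewrite !ptE ?rotXE ?rotYE ?ptE ?cosN ?sinN; ring.
Qed.

(** The orbit of a point of the z-axis is the z-axis itself, which near that point has many points
    over the origin and so cannot lie on a graph. *)
Lemma helical_axis h S f p : h != 0 -> helical h S -> S p ->
  local_graph S p f -> 0 < p 0 0 * p 0 0 + p 0 1 * p 0 1.
Proof.
move=> h0 hel Sp [_ [U [oU Up fE]]].
rewrite lt_def addr_ge0 ?andbT; [|by rewrite -expr2 sqr_ge0..].
apply/eqP => /eqP; rewrite paddr_eq0 -?expr2 ?sqr_ge0// !sqrf_eq0.
move=> /andP[/eqP p0 /eqP p1].
have mE t : helical_motion h t p = pt3 0 0 (p 0 2 + h * t).
  by rewrite /helical_motion p0 p1 !mulr0 subrr addr0.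
have nU : nbhs (0 : R) [set t | U (pt3 0 0 (p 0 2 + h * t))].
  apply: (@nbhs_preimage _ _ (fun t => pt3 0 0 (p 0 2 + h * t)) 0 U) => //.
    apply: pt3_continuous; try exact: cst_continuous.
    apply: continuousD; first exact: cst_continuous.
    by apply: continuousM; [exact: cst_continuous|exact: cvg_id].
  rewrite -mE; suff -> : helical_motion h 0 p = p by [].
  by rewrite mE; apply: pt3_eq; rewrite !ptE ?p0 ?p1// mulr0 addr0.
have fp : p 0 2 = f 0.
  by rewrite (fE _ Sp Up); congr f; apply: pt2_eq; rewrite !ptE !mxE.
near (0 : R)^' => t.
have tU : U (helical_motion h t p).
  by rewrite mE; near: t; exact: cvg_within nU.
have t0 : t != 0 by near: t; exact: nbhs_dnbhs_neq.
have := fE _ (helical_closed t hel Sp) tU; rewrite mE ptE xy_pt3.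
have -> : pt2 0 0 = 0 :> 'rV[R]_2 by apply: pt2_eq; rewrite !ptE !mxE.
rewrite -fp => /eqP; rewrite -subr_eq0 addrAC subrr add0r mulf_eq0.
by rewrite (negbTE h0) (negbTE t0).
Unshelve. all: by end_near. Qed.

Lemma helix_exists h p : 0 < p 0 0 * p 0 0 + p 0 1 * p 0 1 ->
  exists theta, p = helix h (rad p) (p 0 2 - h * theta) theta.
Proof.
move=> /polar_exists[theta [e0 e1]]; exists theta.
by apply: pt3_eq; rewrite !ptE ?subrK.
Qed.

(** A helical motion takes [p] to the half-plane y = 0, x > 0, where [local_profile] applies. Each
    [f q] is an arbitrary graph function, but it agrees with the helical function on an open set
    whose closure contains [xy q], so its first and second derivatives there are those of the
    helical function. *)
Lemma local_structure S h (f : 'rV[R]_3 -> 'rV[R]_2 -> R) p :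
  h != 0 -> helical h S ->
  (forall q, S q -> exists U V Phi Psi, straightening_chart S q U V Phi Psi) ->
  (forall q, S q -> local_graph S q (f q)) -> S p ->
  exists (U : set 'rV[R]_3) (J A : set R) (F : R -> R),
  [/\ open U, U p & forall q, S q -> U q -> let x := rad q in
       let dF := 'D_1 F in let H := hessian (f q) (xy q) in
       [/\ J x, exists psi, q = helix h x (F x) psi,
           q 0 0 * 'D_(delta_mx 0 0) (f q) (xy q) +
           q 0 1 * 'D_(delta_mx 0 1) (f q) (xy q) = x * dF x,
           H 0 0 + H 1 1 = 'D_1 dF x + dF x / x &
           H 0 0 * H 1 1 - H 0 1 * H 1 0 =
             'D_1 dF x * (dF x / x) - (h / x ^+ 2) ^+ 2]] /\
  [/\ forall x, J x -> exists q, [/\ S q, U q & rad q = x],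
      is_interval J, nondegenerate J & forall x, J x -> 0 < x] /\
  [/\ open A, J `<=` A & Ck1 3 A F].
Proof.
move=> h0 hel chart graph Sp.
have q0 := helical_axis h0 hel Sp (graph _ Sp).
have r0 : 0 < rad p by rewrite sqrtr_gt0.
have [theta pE] := helix_exists h q0.
set w := p 0 2 - h * theta in pE.
have S0 : S (pt3 (rad p) 0 w).
  have := helical_closed (- theta) hel Sp.
  by rewrite {1}pE helical_motion_helix addNr helix0.
have [F [U0 [J [A [[oU0 U0p prof] [[Jim iJ nJ J0] [oA JA CF]]]]]]] :=
  local_profile hel r0 S0 (chart _ S0) (graph _ S0).
pose m q := helical_motion h (- theta) q.
pose U := [set q | U0 (m q)].
have oU : open U.
  by apply: open_comp oU0 => q _; exact: helical_motion_continuous.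
have radm q : rad (m q) = rad q.
  by rewrite /m helical_motionN /rad !ptE -[LHS]/(radius _ _ _) radius_rot !ptE.
exists U, J, A, F; split; last first.
  split; last by [].
  split=> // x /Jim[q [Sq Uq rq]]; exists (helical_motion h theta q).
  have E : m (helical_motion h theta q) = q.
    rewrite /m helical_motionN /helical_motion; apply: pt3_eq;
      rewrite !ptE ?rotXE ?rotYE ?ptE; have cs := cos2Dsin2 theta.
    - by rewrite -[RHS]mul1r -cs; ring.
    - by rewrite -[RHS]mul1r -cs; ring.
    - by ring.
  split; first exact: helical_closed.
    by rewrite /U /= E.
  by rewrite -radm E.
split=> //.
  rewrite /U /= /m; move: U0p; congr U0.
  by rewrite {2}pE helical_motion_helix addNr helix0.
pose X := rotX theta; pose Y := rotY theta; pose r := radius X Y.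
(* [X] and [Y] measure the angle from [theta]; the term [h * theta] restores the height that the
   motion [m] takes away. *)
pose E v := helical_fun X Y F h v + h * theta.
(* Over each radius in [J] the surface contains some point; moved to its meridian and then along its
   helix, it reaches the required point. *)
have SE v : 0 < X v -> J (r v) -> S (pt3 (v 0 0) (v 0 1) (E v)).
  move=> Xv Jv; have [q [Sq Uq rq]] := Jim _ Jv.
  have [q00 _ q02] := prof q Sq Uq.
  have := helical_closed (- angle q) hel Sq.
  rewrite helical_motion_meridian// /meridian q02 addrK rq -(helix0 h).
  move=> /(helical_closed (theta + atan (Y v / X v)) hel).
  rewrite helical_motion_helix addr0; congr S.
  have [eX eY] := atan_polar (Y v) Xv; have [e0 e1] := rot_inv theta v.
  apply: pt3_eq; rewrite !ptE.
  - rewrite cosD mulrBr mulrCA [X in _ - X]mulrCA -/X -/Y -eX -eY.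
    by rewrite -e0.
  - rewrite sinD mulrDr mulrCA [X in _ + X]mulrCA -/X -/Y -eX -eY.
    by rewrite -e1.
  - by rewrite /E /helical_fun /r; ring.
move=> q Sq Uq x dF H.
have Smq : S (m q) by exact: helical_closed.
have [mq0 Jm mq2] := prof _ Smq Uq.
have mE : m q = pt3 (X (xy q)) (Y (xy q)) (q 0 2 - h * theta).
  exact: helical_motionN.
have Xq : 0 < X (xy q) by move: mq0; rewrite mE ptE.
rewrite radm in Jm mq2.
have rq : r (xy q) = x by rewrite /r radius_rot !ptE.
have qE : q 0 2 = E (xy q).
  move: mq2; rewrite {1}mE ptE => /(canRL (subrK _)) ->.
  by rewrite /E /helical_fun -/r rq /angle mE !ptE.
have x0 : 0 < x by exact: J0.
have [W' [oWq Wqq Cf]] := (graph q Sq).1; have [U' [oUq' Uqq fE]] := (graph q Sq).2.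
have cX : continuous X by exact: affine_continuous.
have cY : continuous Y by exact: affine_continuous.
have dX i v : is_derive v (delta_mx 0 i) X _ := is_derive_affine _ _ _ i v.
have dY i v : is_derive v (delta_mx 0 i) Y _ := is_derive_affine _ _ _ i v.
pose P := polar_dom X Y A.
have oP : open P by exact: polar_dom_open.
have Pq : P (xy q) by split=> //; rewrite -/(r _) rq; exact: JA.
have CH : Ck (delta_row 2) 3 P (helical_fun X Y F h).
  exact: (Ck_helical_fun cX cY dX dY).
have CE : Ck (delta_row 2) 3 P E := CkD oP CH (Ck_cst _ _ _ oP).
have cE : {for xy q, continuous E} := Ck_continuous CE Pq.
have nB : nbhs (xy q) [set v : 'rV[R]_2 | U' (pt3 (v 0 0) (v 0 1) (E v))].
  apply: (@nbhs_preimage _ _ (fun v : 'rV[R]_2 => pt3 (v 0 0) (v 0 1) (E v))) => //.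
    by apply: pt3_continuous => //; exact: coord_continuous.
  suff -> : pt3 (xy q 0 0) (xy q 0 1) (E (xy q)) = q by [].
  by apply: pt3_eq; rewrite !ptE.
pose B := [set v : 'rV[R]_2 | U' (pt3 (v 0 0) (v 0 1) (E v))]°.
have oB : open B by exact: open_interior.
(* Over [O] the graph of [E] lies on S and inside the neighbourhood where S is the graph of [f q],
   whence [f q = E] on [O]. Taking the interior of [J] makes [O] open. *)
pose O := B `&` polar_dom X Y J°.
have oO : open O by apply: openI => //; apply: polar_dom_open => //; exact: open_interior.
have fEO v : O v -> f q v = E v.
  move=> [Bv [Xv Jv]]; have := fE _ (SE v Xv (interior_subset Jv)) (interior_subset Bv).
  rewrite ptE xy_pt3 => ->; congr (f q _).
  by apply: pt2_eq; rewrite !ptE.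
have clO : closure O (xy q).
  (* [xy q] is approached along its ray: [K t] is the point of radius [t] on it, and [t] runs
     through interior points of [J]. *)
  move=> C nC; pose K (t : R) : 'rV[R]_2 := (t / x) *: xy q.
  have Kx : K x = xy q by rewrite /K divff ?scale1r// gt_eqF.
  have nK : nbhs x (K @^-1` (C `&` B)).
    have : {for x, continuous K}.
      apply: continuousZr_tmp; apply: continuousM; first exact: cvg_id.
      exact: cst_continuous.
    apply; rewrite -/(K x) Kx; apply: filterI => //.
    exact: nbhs_interior.
  have [t [Jt [Ct Bt]]] := interval_closure_interior iJ nJ Jm nK.
  have t0 : 0 < t by apply: J0; exact: interior_subset.
  exists (K t); split=> //; split=> //; split.
    by rewrite /X rotX_scale mulr_gt0// divr_gt0.
  suff -> : radius X Y (K t) = t by [].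
  rewrite radius_rot !mxE -[RHS](gtr0_norm t0) -[RHS]sqrtr_sqr.
  have x2 := radius_sqr X Y (xy q); rewrite -/r rq in x2.
  have {}x2 : q 0 0 * q 0 0 + q 0 1 * q 0 1 = x * x.
    by rewrite -[RHS]expr2 /x /rad sqr_sqrtr// addr_ge0// -expr2 sqr_ge0.
  congr Num.sqrt; rewrite /= -[RHS]mulr1.
  have -> : 1 = (q 0 0 * q 0 0 + q 0 1 * q 0 1) / (x * x) :> R.
    by rewrite x2 divff// mulf_neq0// gt_eqF.
  by field; rewrite gt_eqF.
have Wq1 : (W' `&` P) (xy q) by [].
have Cf3 : Ck (delta_row 2) 3 (W' `&` P) (f q).
  by apply: (@Ck_subset _ _ _ _ _ W') => [v []|] //; exact/Ck_onE.
have CE3 : Ck (delta_row 2) 3 (W' `&` P) E.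
  by apply: (@Ck_subset _ _ _ _ _ P) => // v [].
have D1 i : 'D_(delta_mx 0 i) (f q) (xy q) =
    'D_(delta_mx 0 i) (helical_fun X Y F h) (xy q).
  have -> : 'D_(delta_mx 0 i) (f q) (xy q) = 'D_(delta_mx 0 i) E (xy q).
    by apply: (eq_jet1 oO fEO i (CkS (CkS Cf3)) (CkS (CkS CE3)) Wq1 clO).
  by have := congr1 (fun g => g (xy q))
    (derive_addc (helical_fun X Y F h) (h * theta) (delta_mx 0 i)).
have D2 : H = hessian (helical_fun X Y F h) (xy q).
  apply/matrixP => i j; rewrite [LHS]mxE [RHS]mxE.
  apply: (etrans (eq_jet2 i j oO fEO (CkS Cf3) (CkS CE3) Wq1 clO)).
  exact: (congr1 (fun g => 'D_(delta_mx 0 i) g (xy q))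
    (derive_addc (helical_fun X Y F h) (h * theta) (delta_mx 0 j))).
have Ax : A x by exact: JA.
have DF y : A y -> is_derive y 1 F (dF y).
  exact: Ck1_is_derive CF.
have DdF : is_derive x 1 dF ('D_1 dF x).
  exact: Ck1_is_derive (Ck1_derive CF) Ax.
split.
- exact: Jm.
- exists (theta + atan (Y (xy q) / X (xy q))).
  have [eX eY] := atan_polar (Y (xy q)) Xq; have [e0 e1] := rot_inv theta (xy q).
  rewrite -/X -/Y in e0 e1; rewrite -/(radius X Y (xy q)) -/r rq in eX eY.
  apply: pt3_eq; rewrite !ptE.
  + rewrite cosD mulrBr mulrCA [X in _ - X]mulrCA -eX -eY.
    by rewrite -e0 ptE.
  + rewrite sinD mulrDr mulrCA [X in _ + X]mulrCA -eX -eY.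
    by rewrite -e1 ptE.
  + by rewrite qE /E /helical_fun -/r rq; ring.
- rewrite !D1; have Dr : is_derive (r (xy q)) 1 F (dF x) by rewrite rq; exact: DF.
  have [_ ->] := is_derive_helical_fun dX dY h 0 Xq Dr.
  have [_ ->] := is_derive_helical_fun dX dY h 1 Xq Dr.
  have := radius_sqr X Y (xy q); rewrite -/r rq => r2.
  have [e0 e1] := rot_inv theta (xy q); rewrite -/X -/Y !ptE in e0 e1.
  have dX0 : daffine ((-1) ^+ false * cos theta)
      (- ((-1) ^+ false * - sin theta)) 0 = cos theta.
    by rewrite /daffine /= expr0; ring.
  have dX1 : daffine ((-1) ^+ false * cos theta)
      (- ((-1) ^+ false * - sin theta)) 1 = sin theta.
    by rewrite /daffine /= expr0; ring.
  have dY0 : daffine (- sin theta) (cos theta) 0 = - sin theta.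
    by rewrite /daffine /=; ring.
  have dY1 : daffine (- sin theta) (cos theta) 1 = cos theta.
    by rewrite /daffine /=; ring.
  have Xe : q 0 0 * cos theta + q 0 1 * sin theta = X (xy q).
    by rewrite /X rotXE !ptE; ring.
  have Ye : q 0 1 * cos theta - q 0 0 * sin theta = Y (xy q).
    by rewrite /Y rotYE !ptE; ring.
  rewrite dX0 dX1 dY0 dY1.
  (* The two brackets are X and Y, so the term with factor h, the radial derivative of the polar
     angle, cancels. *)
  transitivity (dF x / x * (X (xy q) * (q 0 0 * cos theta + q 0 1 * sin theta)
     + Y (xy q) * (q 0 1 * cos theta - q 0 0 * sin theta))
     + h / (x * x) * (X (xy q) * (q 0 1 * cos theta - q 0 0 * sin theta)
       - Y (xy q) * (q 0 0 * cos theta + q 0 1 * sin theta))).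
    by field; rewrite gt_eqF.
  by rewrite Xe Ye -r2; field; rewrite gt_eqF.
- rewrite D2.
  have DdFr : is_derive (r (xy q)) 1 dF ('D_1 dF x) by rewrite rq.
  have [-> _] := conformal_hessian h oA Pq DF DdFr.
  by rewrite -/X -/Y -/r rq sqrrN addrC -[X in X * _]addrC cos2Dsin2 mul1r addrC.
- rewrite D2.
  have DdFr : is_derive (r (xy q)) 1 dF ('D_1 dF x) by rewrite rq.
  have [_ ->] := conformal_hessian h oA Pq DF DdFr.
  by rewrite -/X -/Y -/r rq sqrrN cos2Dsin2 expr1n mul1r.
Qed.

End LocalStructure.

(** * Matrices and the surfaces r_a *)

Section Matrices.
Variable R : realType.

Lemma det_mx2 (K : comPzRingType) (A : 'M[K]_2) :
  \det A = A 0 0 * A 1 1 - A 0 1 * A 1 0.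
Proof.
rewrite (expand_det_row _ 0) !big_ord_recl big_ord0 /cofactor !det_mx11 !mxE.
rewrite /= !addr0 expr0 expr1 mul1r mulN1r mulrN.
by congr (_ * A _ _ - A _ _ * A _ _); apply/val_inj.
Qed.

Lemma sum_ord3 (F : 'I_3 -> R) : \sum_i F i = F 0 + F 1 + F 2.
Proof.
rewrite !big_ord_recl big_ord0 addr0 addrA.
by congr (_ + F _ + F _); apply/val_inj.
Qed.

Lemma char_poly2P (A : 'M[R]_2) (k1 k2 : R) :
  char_poly A = ('X - k1%:P) * ('X - k2%:P) <->
  A 0 0 + A 1 1 = k1 + k2 /\ A 0 0 * A 1 1 - A 0 1 * A 1 0 = k1 * k2.
Proof.
have -> : char_poly A = ('X - (A 0 0)%:P) * ('X - (A 1 1)%:P)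
    - (A 0 1)%:P * (A 1 0)%:P.
  by rewrite /char_poly det_mx2 !mxE /= !mulr0n !mulr1n !sub0r mulrNN.
split=> [E|[tr dt]].
  (* The values at 0 and 1 of the two monic quadratic polynomials determine determinant and
     trace. *)
  have := congr1 (horner ^~ 0) E; have := congr1 (horner ^~ 1) E.
  by rewrite !hornerE => E1 E0; split; lra.
have -> : ('X - k1%:P) * ('X - k2%:P) =
    'X ^+ 2 - (k1 + k2)%:P * 'X + (k1 * k2)%:P :> {poly R} by ring.
by rewrite -tr -dt; ring.
Qed.

Lemma det_similarity s (h1 h2 c1 c2 c3 : R) :
  \det (iso_similarity_mx s h1 h2 c1 c2 c3) =
  (-1) ^+ s * (h1 ^+ 2 + h2 ^+ 2) * c3.
Proof.
rewrite (expand_det_col _ 2) sum_ord3 /cofactor !det_mx2 !mxE /=.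
by rewrite !mul0r !add0r; case: s; rewrite /= ?expr0 ?expr1; ring.
Qed.

Lemma similarity_coord s (h1 h2 c1 c2 c3 : R) (b q : 'rV[R]_3) :
  let g := q *m (iso_similarity_mx s h1 h2 c1 c2 c3)^T + b in
  [/\ g 0 0 = (-1) ^+ s * h1 * q 0 0 - (-1) ^+ s * h2 * q 0 1 + b 0 0,
      g 0 1 = h2 * q 0 0 + h1 * q 0 1 + b 0 1 &
      g 0 2 = c1 * q 0 0 + c2 * q 0 1 + c3 * q 0 2 + b 0 2].
Proof. by move=> g; rewrite /g; split; rewrite !mxE sum_ord3 !mxE /=; ring. Qed.

(** The set on which [inv] takes its value at [p] is open and closed in [S]: near each point this
    value is either taken everywhere or avoided. *)
Lemma connected_constant (T : topologicalType) (X : Type) (S : set T)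
    (inv : T -> X) : connected S ->
  (forall p, S p -> exists U, [/\ open U, U p &
     forall q, S q -> U q -> inv q = inv p]) ->
  forall p q, S p -> S q -> inv q = inv p.
Proof.
move=> cS loc p q Sp Sq.
pose B := [set y | S y /\ inv y = inv p].
suff BS : B = S by move: Sq; rewrite -BS => -[].
pose O := [set y | exists U, [/\ open U, U y & forall z, S z -> U z -> inv z = inv p]].
have oO : open O.
  rewrite openE => y [U [oU Uy UE]]; apply: filterS (open_nbhs_nbhs (conj oU Uy)).
  by move=> z Uz; exists U.
pose N := [set y | exists U, [/\ open U, U y & forall z, S z -> U z -> inv z <> inv p]].
have oN : open N.
  rewrite openE => y [U [oU Uy UE]]; apply: filterS (open_nbhs_nbhs (conj oU Uy)).
  by move=> z Uz; exists U.
apply: cS; first by exists p.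
- exists O => //; apply/seteqP; split=> y [Sy].
    move=> e; split=> //; have [U [oU Uy UE]] := loc y Sy.
    by exists U; split=> // z Sz Uz; rewrite -e; exact: UE.
  by move=> [U [_ Uy UE]]; split=> //; exact: UE.
- exists (~` N); first by rewrite closedC.
  apply/seteqP; split=> y [Sy].
    by move=> e; split=> // -[U [_ Uy]] /(_ y Sy Uy); apply.
  move=> nN; split=> //; apply: contrapT => ne; apply: nN.
  have [U [oU Uy UE]] := loc y Sy; exists U; split=> // z Sz Uz.
  by rewrite UE.
Qed.

End Matrices.

(** * The generatrix of [r_a] in the variable t = tan u, and its parameter intervals *)

Section Generatrix.
Variable R : realType.
Implicit Types (a t u : R).

Lemma cos_atan_gt0 t : 0 < cos (atan t).
Proof. by rewrite cos_gt0_pihalf// atan_gtNpi2 atan_ltpi2. Qed.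

Lemma sin_atan t : sin (atan t) = t * cos (atan t).
Proof. by rewrite -{2}(atanK t) /tan mulfVK// gt_eqF// cos_atan_gt0. Qed.

Lemma atan_gt0 t : 0 < t -> 0 < atan t < pi / 2.
Proof. by move=> t0; rewrite atan_ltpi2 andbT -(atan0 R) lt_atan. Qed.

Lemma ln_cos_atan t : ln (cos (atan t)) = - (ln (1 + t ^+ 2) / 2).
Proof.
have q0 : 0 < 1 + t ^+ 2 by rewrite ltr_wpDr// sqr_ge0.
have s0 : 0 < Num.sqrt (1 + t ^+ 2) by rewrite sqrtr_gt0.
rewrite cos_atan lnV ?posrE//; congr (- _).
by rewrite -{2}(sqr_sqrtr (ltW q0)) expr2 lnM ?posrE//; field.
Qed.

Lemma ln_sin_atan t : 0 < t -> ln (sin (atan t)) = ln t - ln (1 + t ^+ 2) / 2.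
Proof.
by move=> t0; rewrite sin_atan lnM ?posrE ?cos_atan_gt0// ln_cos_atan.
Qed.

(* The coordinates of [r_a] in terms of t = tan u. *)
Definition ra_radius a t := expR (ln (1 + t ^+ 2) / 2 - a / (a + 1) * ln t).
Definition ra_height a t :=
  atan t + t / (a ^+ 2 - 1) + a ^+ 2 / (a ^+ 2 - 1) / t.

Lemma r_a_atan a t v : a + 1 != 0 -> 0 < t ->
  r_a a (atan t) v = helix 1 (ra_radius a t) (ra_height a t) v.
Proof.
move=> a1 t0; have c0 := cos_atan_gt0 t.
have s0 : 0 < sin (atan t) by rewrite sin_atan mulr_gt0.
rewrite /r_a; set rho := _ `^ (- _).
(* Both radii are positive, so it suffices to compare logarithms. *)
have rhoE : rho = ra_radius a t.
  have rho0 : 0 < rho by rewrite powR_gt0// mulr_gt0// powR_gt0.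
  rewrite -[LHS]lnK ?posrE//; congr expR.
  rewrite ln_powR lnM ?posrE ?powR_gt0// ln_powR ln_cos_atan ln_sin_atan//.
  by field.
rewrite rhoE atanK; apply: pt3_eq; rewrite !ptE; try exact: mulrC.
rewrite sin_atan /ra_height; have -> : cos (atan t) / (t * cos (atan t)) = t^-1.
  by field; rewrite !gt_eqF.
by ring.
Qed.

Lemma pihalf_itv u : 0 < u < pi / 2 -> u \in `](- (pi / 2)), (pi / 2)[.
Proof.
move=> /andP[u0 u1]; rewrite in_itv /= u1 andbT.
by rewrite (lt_trans _ u0)// oppr_lt0 divr_gt0// pi_gt0.
Qed.

Lemma tan_gt0_pihalf u : 0 < u < pi / 2 -> 0 < tan u.
Proof.
move=> u01; rewrite -(tan0 R) ltr_tan//; first by case/andP: u01.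
  by rewrite in_itv /= oppr_lt0 divr_gt0// pi_gt0.
exact: pihalf_itv.
Qed.

(** Since tan^2 is increasing on (0, pi/2), the sign of tan^2 u - a singles out a component of the
    parameter domain: for t > 0 and t^2 different from a, the one containing atan t. *)
Definition ra_component a t := [set u : R |
  [/\ 0 < u < pi / 2, tan u ^+ 2 != a & (0 < tan u ^+ 2 - a) = (0 < t ^+ 2 - a)]].

Lemma le_tan_sqr u u' : 0 < u < pi / 2 -> 0 < u' < pi / 2 -> u <= u' ->
  tan u ^+ 2 <= tan u' ^+ 2.
Proof.
move=> u01 u01' uu; rewrite ler_sqr ?nnegrE; [|by rewrite ltW// tan_gt0_pihalf..].
move: uu; rewrite le_eqVlt => /orP[/eqP -> //|uu].
by rewrite ltW// ltr_tan ?pihalf_itv.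
Qed.

Lemma ra_component_interval a t : is_interval (ra_component a t).
Proof.
move=> u w [u01 ua us] [w01 wa ws] z /andP[uz zw].
have z01 : 0 < z < pi / 2.
  by case/andP: u01 w01 => u0 _ /andP[_ w1]; rewrite (lt_le_trans u0)//= (le_lt_trans zw).
have tu := le_tan_sqr u01 z01 uz; have tw := le_tan_sqr z01 w01 zw.
move: us ws; case E : (0 < t ^+ 2 - a) => us ws.
  have h0 : 0 < tan z ^+ 2 - a.
    by apply: lt_le_trans (_ : tan u ^+ 2 - a <= _); rewrite ?us ?lerD2r.
  by split; rewrite ?h0 ?E// -subr_eq0 gt_eqF.
have h0 : tan z ^+ 2 - a < 0.
  have : tan w ^+ 2 - a < 0 by rewrite lt_neqAle subr_eq0 wa leNgt ws.
  by apply: le_lt_trans; rewrite lerD2r.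
by split=> //; [rewrite -subr_eq0 lt_eqF|rewrite E; apply/negbTE; rewrite -leNgt ltW].
Qed.

Lemma parameter_interval_component a t : 0 < t -> t ^+ 2 != a ->
  parameter_interval a (ra_component a t).
Proof.
move=> t0 ta; have u01 := atan_gt0 t0; have [u0 u1] := andP u01.
split; [exact: ra_component_interval| |by move=> u []|by move=> u []].
have Iu : ra_component a t (atan t) by split; rewrite ?atanK.
(* A second parameter is taken on the side away from the excluded value: above atan t if t^2 > a,
   below it otherwise. *)
have [s|s] := ltP 0 (t ^+ 2 - a).
  pose w := (atan t + pi / 2) / 2; have uw : atan t < w < pi / 2.
    by rewrite /w; apply/andP; split; lra.
  have [uw1 uw2] := andP uw.
  have w01 : 0 < w < pi / 2 by rewrite uw2 (lt_trans u0).
  have := le_tan_sqr u01 w01 (ltW uw1); rewrite atanK => tw.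
  have h0 : 0 < tan w ^+ 2 - a by apply: lt_le_trans s _; rewrite lerD2r.
  exists (atan t), w; split=> //; split=> //; first by rewrite -subr_eq0 gt_eqF.
  by rewrite h0 s.
pose w := atan t / 2; have wu : 0 < w < atan t by rewrite /w; apply/andP; split; lra.
have [w0 wu2] := andP wu.
have w01 : 0 < w < pi / 2 by rewrite w0 (lt_trans wu2).
have := le_tan_sqr w01 u01 (ltW wu2); rewrite atanK => tw.
have s' : t ^+ 2 - a < 0 by rewrite lt_neqAle s subr_eq0 ta.
have h0 : tan w ^+ 2 - a < 0 by apply: le_lt_trans s'; rewrite lerD2r.
exists w, (atan t); split=> //; split=> //; first by rewrite -subr_eq0 lt_eqF.
by rewrite !ltNge ltW//= s.
Qed.

End Generatrix.

(** * Necessity *)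

(** The eigenvalues are [k] and [a * k]; this form absorbs the two possible orders of the
    quotient. *)
Definition ratio_hessian (R : realType) (a : R) (H : 'M[R]_2) : Prop :=
  exists k, [/\ k != 0, H 0 0 + H 1 1 = (1 + a) * k &
    H 0 0 * H 1 1 - H 0 1 * H 1 0 = a * k ^+ 2].

Lemma ratio_hessianP (R : realType) (a : R) (H : 'M[R]_2) : a != 0 ->
  ratio_hessian a H <-> exists k1 k2,
    [/\ char_poly H = ('X - k1%:P) * ('X - k2%:P), k1 * k2 != 0 &
        k1 / k2 = a \/ k2 / k1 = a].
Proof.
move=> a0; split=> [[k [k0 tr dt]]|[k1 [k2 [/char_poly2P[tr dt] k12 ka]]]].
  exists k, (a * k); split; [|by rewrite !mulf_neq0|by right; rewrite mulfK].
  by apply/char_poly2P; rewrite tr dt; split; ring.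
move: k12; rewrite mulf_eq0 negb_or => /andP[k10 k20].
by case: ka => <-; [exists k2|exists k1]; split=> //; rewrite ?tr ?dt; field.
Qed.

Section Necessity.
Variables (R : realType) (a h : R) (S : set 'rV[R]_3).
Hypotheses (a0 : a != 0) (h0 : h != 0).
Hypotheses (surfS : surface S) (hel : helical h S).
Implicit Types (p q : 'rV[R]_3) (f : 'rV[R]_3 -> 'rV[R]_2 -> R) (x : R).

Lemma constant_ratio_graphs : constant_ratio a S -> exists f,
  forall q, S q -> local_graph S q (f q) /\ ratio_hessian a (hessian (f q) (xy q)).
Proof.
move=> rat; have H q : exists g : 'rV[R]_2 -> R,
    S q -> local_graph S q g /\ ratio_hessian a (hessian g (xy q)).
  have [Sq|nS] := pselect (S q); last by exists (fun=> 0).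
  have [k1 [k2 [[g [gf cp]] k12 ka]]] := rat q Sq.
  by exists g => _; split=> //; apply/ratio_hessianP => //; exists k1, k2.
by have [f Hf] := choice H; exists f.
Qed.

Variable f : 'rV[R]_3 -> 'rV[R]_2 -> R.
Hypothesis graph : forall q, S q -> local_graph S q (f q).
Hypothesis curv : forall q, S q -> ratio_hessian a (hessian (f q) (xy q)).

(** The quantities s, L and t of the surface scaled to pitch 1, read off from [f q] at each point.
    Being defined on all of S, they link the local first integrals of different neighbourhoods. *)
Let slope_at q := (q 0 0 * 'D_(delta_mx 0 0) (f q) (xy q) +
  q 0 1 * 'D_(delta_mx 0 1) (f q) (xy q)) / h.
Let trace_at q := rad q ^+ 2 *
  (hessian (f q) (xy q) 0 0 + hessian (f q) (xy q) 1 1) / h.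
Let tau_at q := a * (trace_at q / (1 + a)) - slope_at q.

(* The sign of c = 1 / h or - 1 / h is a choice: the one making tau positive is
   taken below. *)
Lemma profile_at p : S p -> exists (U : set 'rV[R]_3) (J A : set R) (F : R -> R),
  [/\ open U, U p & forall q, S q -> U q ->
       J (rad q) /\ exists psi, q = helix h (rad q) (F (rad q)) psi] /\
  [/\ J (rad p), is_interval J, nondegenerate J & forall x, J x -> 0 < x] /\
  [/\ open A, J `<=` A & exists dF d2F d3F : R -> R,
    [/\ forall x, A x -> is_derive x 1 F (dF x),
        forall x, A x -> is_derive x 1 dF (d2F x),
        forall x, A x -> is_derive x 1 d2F (d3F x),
        forall x, A x -> {for x, continuous d3F} &
        forall c, (c * h) ^+ 2 = 1 ->
          let s := slope (fun x => c * dF x) in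
          let L := trace_fun (fun x => c * dF x) (fun x => c * d2F x) in
          [/\ forall q, S q -> U q -> s (rad q) = c * h * slope_at q /\
                L (rad q) = c * h * trace_at q &
              forall x, J x -> exists k, L x = (1 + a) * k /\
                s x * (L x - s x) - 1 = a * k ^+ 2]]].
Proof.
move=> Sp; have [_ _ chart] := surfS.
have [U [J [A [F [[oU Up HU] [[Jim iJ nJ J0] [oA JA CF]]]]]]] :=
  local_structure h0 hel chart graph Sp.
exists U, J, A, F; split.
  by split=> // q Sq Uq; have [Jq psiq _ _ _] := HU q Sq Uq.
split; first by split=> //; have [] := HU p Sp Up.
split=> //; exists ('D_1 F), ('D_1 ('D_1 F)), ('D_1 ('D_1 ('D_1 F))).
have C1 := Ck1_derive CF; have C2 := Ck1_derive C1; have C3 := Ck1_derive C2.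
split.
- by move=> x; exact: Ck1_is_derive CF.
- by move=> x; exact: Ck1_is_derive C1.
- by move=> x; exact: Ck1_is_derive C2.
- by move=> x Ax; exact: (Ck_continuous C3 Ax).
move=> c ch s L.
have key q : S q -> U q -> s (rad q) = c * h * slope_at q /\
    L (rad q) = c * h * trace_at q.
  move=> Sq Uq; have [Jq _ E1 E2 _] := HU q Sq Uq; have x0 := J0 _ Jq.
  rewrite /slope_at /trace_at E1 E2 /s /L /slope /trace_fun.
  by split; field; rewrite ?h0 ?gt_eqF.
split=> // x /Jim[q [Sq Uq <-]]; have [Jq _ E1 E2 E3] := HU q Sq Uq.
have x0 := J0 _ Jq; have [k [_ tr dt]] := curv Sq.
have [sE LE] := key q Sq Uq; exists (c * rad q ^+ 2 * k); split.
  rewrite LE /trace_at tr; field; exact: h0.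
transitivity (c ^+ 2 * rad q ^+ 4 * (a * k ^+ 2)); last by ring.
rewrite -dt E3 /s /L /slope /trace_fun -ch.
by field; rewrite gt_eqF.
Qed.

(** For a = 1 the relation (a k - s) (s - k) = 1 becomes (s - k)^2 = -1. *)
Lemma ratio_neq1 : a != 1.
Proof.
have [[p Sp] _ _] := surfS; apply/eqP => a1.
have [U [J [A [F [_ [[Jp _ _ _] [_ _ [dF [d2F [d3F [_ _ _ _]]]]]]]]]]] := profile_at Sp.
have hV : (h^-1 * h) ^+ 2 = 1 by rewrite mulVf// expr1n.
move=> /(_ _ hV)[_ /(_ _ Jp)[k []]]; set s := slope _ _; set L := trace_fun _ _ _.
rewrite a1 => -> E; have : (s - k) ^+ 2 = -1 by lra.
by move=> E2; have := sqr_ge0 (s - k); rewrite E2 oppr_ge0 ler10.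
Qed.

(** Polar angles are determined up to full turns only, so that Z - psi = Z0 is expressed by cosine
    and sine; then Z - Z0 is also a polar angle of [q]. *)
Lemma helix_spread q Z Z0 psi : 0 <= rad q -> q = helix h (rad q) (q 0 2 - h * psi) psi ->
  cos (Z - psi) = cos Z0 -> sin (Z - psi) = sin Z0 ->
  q 0 0 = rad q * cos (Z - Z0) /\ q 0 1 = rad q * sin (Z - Z0).
Proof.
move=> r0 qE cE sE; have -> : q 0 0 = rad q * cos psi by rewrite {1}qE ptE.
have -> : q 0 1 = rad q * sin psi by rewrite {1}qE ptE.
rewrite cosB sinB -cE -sE -sinB -cosB.
by rewrite (_ : Z - (Z - psi) = psi)//; ring.
Qed.

(** For e = -1 the map reverses y and z together, which keeps the pitch but replaces F by - F and t
    by - t. In the matrix h1 = e / C, and the sign of the first row turns this into 1 / C. *)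
Lemma similarity_spread (e C k0 : R) (g : 'rV[R]_3 -> 'rV[R]_3) (s : bool) :
  C != 0 -> e = (-1) ^+ s ->
  (forall q, g q = pt3 (q 0 0 / C) (e * (q 0 1 / C)) (e * (q 0 2 / h - k0))) ->
  iso_similarity g.
Proof.
move=> C0 eE gE; have e2 : e * e = 1 by rewrite eE -expr2 sqrr_sign.
exists s, (e / C), 0, 0, 0, (e / h), (pt3 0 0 (- (e * k0))); split.
  rewrite unitmxE unitfE det_similarity.
  have e0 : e != 0 by rewrite eE signr_eq0.
  rewrite !mulf_neq0 ?signr_eq0 ?invr_neq0// expr0n addr0 expf_neq0//.
  by rewrite mulf_neq0 ?invr_neq0.
move=> q; have [E0 E1 E2] :=
  similarity_coord s (e / C) 0 0 0 (e / h) (pt3 0 0 (- (e * k0))) q.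
rewrite gE; apply: pt3_eq; rewrite ?E0 ?E1 ?E2 !ptE.
- by rewrite -eE; transitivity (e * e * (q 0 0 / C)); [rewrite e2 mul1r|ring].
- by ring.
- by ring.
Qed.

(** The left-hand sides do not involve [theta], so for Z depending on [q] they are functions on S,
    free of any choice of polar angle. *)
Lemma helix_phase q x z theta Z : x != 0 -> q = helix h x z theta ->
  (q 0 0 * cos Z + q 0 1 * sin Z) / x = cos (Z - theta) /\
  (q 0 0 * sin Z - q 0 1 * cos Z) / x = sin (Z - theta).
Proof. by move=> x0 ->; rewrite !ptE cosB sinB; split; field. Qed.

(** * Necessity for ratios different from -1 *)

Section Generic.
Hypothesis aN1 : a != -1.

(** [eps q] is the sign of [tau_at q], and [T_at q] is the tangent of the parameter u after the
    corresponding reflection. By the first integral of the height, [Z_at q] minus the polar angle is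
    locally constant up to full turns. *)
Let T_at q := `|tau_at q|.
Let eps q : R := (-1) ^+ (~~ (0 < tau_at q)).
Let Z_at q := q 0 2 / h - eps q * ra_height a (T_at q).

(* The first two components are the connected component of the parameter domain,
   the third one the first integral of the radius; the last two are the cosine
   and the sine of Z - theta, where theta is the polar angle. *)
Let invariant q :=
  ((0 < tau_at q, 0 < T_at q ^+ 2 - a),
   (a + 1) * ln (rad q) - (a + 1) / 2 * ln (1 + T_at q ^+ 2) + a * ln (T_at q),
   ((q 0 0 * cos (Z_at q) + q 0 1 * sin (Z_at q)) / rad q,
    (q 0 0 * sin (Z_at q) - q 0 1 * cos (Z_at q)) / rad q)).

(** On the interval [J] the function tau has no zero, hence a constant sign. Once c is chosen by
    this sign, [tau2_neq] and the two first integrals of the profile give the rest. *)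
Lemma invariant_local p : S p -> exists U, [/\ open U, U p &
  forall q, S q -> U q ->
    [/\ 0 < T_at q, T_at q ^+ 2 != a & invariant q = invariant p]].
Proof.
move=> Sp; have a1 : 1 + a != 0 by rewrite addrC -[1]opprK subr_eq0.
have [U [J [A [F [[oU Up HU] [[Jp iJ nJ J0] [oA JA [dF [d2F [d3F
  [DF DdF Dd2F cd3F ode]]]]]]]]]]] := profile_at Sp.
have tauE c : (c * h) ^+ 2 = 1 -> forall q, S q -> U q ->
    tau a (fun x => c * dF x) (fun x => c * d2F x) (rad q) = c * h * tau_at q.
  move=> ch q Sq Uq; have [/(_ q Sq Uq)[sE LE] _] := ode c ch.
  by rewrite /tau /kappa sE LE /tau_at; ring.
have odeE c : (c * h) ^+ 2 = 1 -> forall x, J x ->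
    slope (fun x => c * dF x) x * (trace_fun (fun x => c * dF x) (fun x => c * d2F x) x
      - slope (fun x => c * dF x) x) - 1 =
    a * kappa a (fun x => c * dF x) (fun x => c * d2F x) x ^+ 2.
  move=> ch x Jx; have [_ /(_ x Jx)[k [kE ->]]] := ode c ch.
  by congr (a * _ ^+ 2); rewrite /kappa kE; field.
have DFc c x : A x -> is_derive x 1 (fun x => c * F x) (c * dF x).
  by move=> Ax; apply: is_derive_scale; exact: DF.
have DdFc c x : A x -> is_derive x 1 (fun x => c * dF x) (c * d2F x).
  by move=> Ax; apply: is_derive_scale; exact: DdF.
have Dd2Fc c x : A x -> is_derive x 1 (fun x => c * d2F x) (c * d3F x).
  by move=> Ax; apply: is_derive_scale; exact: Dd2F.
have cd3Fc c x : A x -> {for x, continuous (fun x => c * d3F x)}.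
  by move=> Ax; apply: continuousM; [exact: cst_continuous|exact: cd3F].
have hV : (h^-1 * h) ^+ 2 = 1 by rewrite mulVf// expr1n.
have tau1 q : S q -> U q ->
    tau a (fun x => h^-1 * dF x) (fun x => h^-1 * d2F x) (rad q) = tau_at q.
  by move=> Sq Uq; rewrite tauE// mulVf// mul1r.
have Jq q : S q -> U q -> J (rad q) by move=> Sq Uq; have [] := HU q Sq Uq.
have sgE x y : J x -> J y ->
    (0 < tau a (fun x => h^-1 * dF x) (fun x => h^-1 * d2F x) x) =
    (0 < tau a (fun x => h^-1 * dF x) (fun x => h^-1 * d2F x) y).
  move=> Jx Jy; apply: (interval_sign iJ _ _ Jx Jy) => z Jz.
    exact: (tau_continuous (DdFc _) (Dd2Fc _) (JA _ Jz)).
  exact: (tau_neq0 aN1 (odeE _ hV) Jz).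
have sgq q : S q -> U q -> (0 < tau_at q) = (0 < tau_at p).
  by move=> Sq Uq; rewrite -!tau1//; apply: sgE; apply: Jq.
have t0q q : S q -> U q -> tau_at q != 0.
  move=> Sq Uq; rewrite -tau1//.
  exact: (tau_neq0 aN1 (odeE _ hV) (Jq q Sq Uq)).
have epsq q : S q -> U q -> eps q = eps p by move=> Sq Uq; rewrite /eps sgq.
(* With this sign the [tau] of the profile c F equals [T_at]; it is positive, as the logarithms in
   the first integrals require. *)
pose c := eps p / h.
have ch1 : c * h = eps p by rewrite /c mulfVK.
have ch : (c * h) ^+ 2 = 1 by rewrite ch1 /eps sqrr_sign.
have TE q : S q -> U q -> tau a (fun x => c * dF x) (fun x => c * d2F x) (rad q) = T_at q.
  move=> Sq Uq; rewrite tauE// ch1 -(epsq q Sq Uq) /eps /T_at.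
  case: (ltgtP (tau_at q) 0) (t0q q Sq Uq) => //= t0 _.
    by rewrite expr1 mulN1r ltr0_norm.
  by rewrite expr0 mul1r gtr0_norm.
have tau_pos x : J x -> 0 < tau a (fun x => c * dF x) (fun x => c * d2F x) x.
  move=> Jx; suff E : (0 < tau a (fun x => c * dF x) (fun x => c * d2F x) x) =
      (0 < tau a (fun x => c * dF x) (fun x => c * d2F x) (rad p)).
    by rewrite E TE// normr_gt0 t0q.
  apply: (interval_sign iJ _ _ Jx Jp) => z Jz.
    exact: (tau_continuous (DdFc _) (Dd2Fc _) (JA _ Jz)).
  exact: (tau_neq0 aN1 (odeE _ ch) Jz).
have tau2 x : J x -> tau a (fun x => c * dF x) (fun x => c * d2F x) x ^+ 2 - a != 0.
  exact: (tau2_neq JA iJ nJ J0 (DdFc c) (Dd2Fc c) (cd3Fc c) aN1 (odeE _ ch)).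
exists U; split=> // q Sq Uq; split.
- by rewrite normr_gt0 t0q.
- by rewrite -TE// -subr_eq0 tau2//; exact: Jq.
have [Jrq [psi qE]] := HU q Sq Uq; have [_ [psi0 pE]] := HU p Sp Up.
have am1 : a - 1 != 0 by rewrite subr_eq0 ratio_neq1.
have rad0 y : J y -> y != 0 by move=> /J0; exact: lt0r_neq0.
have ZE y theta : S y -> U y -> y = helix h (rad y) (F (rad y)) theta ->
    Z_at y - theta = eps p * (c * F (rad y) - ra_height a (T_at y)).
  move=> Sy Uy yE; rewrite /Z_at epsq// {1}yE ptE.
  transitivity (eps p * eps p * (F (rad y) / h) - eps p * ra_height a (T_at y)).
    by rewrite -expr2 sqrr_sign; field.
  by rewrite /c; ring.
have ZpE : Z_at q - psi = Z_at p - psi0.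
  rewrite (ZE q psi Sq Uq qE) (ZE p psi0 Sp Up pE); congr (_ * _).
  have := profile_height JA iJ nJ J0 (DFc c) (DdFc c) (Dd2Fc c) (cd3Fc c) aN1
    (odeE _ ch) tau_pos Jrq Jp am1.
  by rewrite (TE q Sq Uq) (TE p Sp Up) /ra_height !opprD !addrA.
have spread y theta : J (rad y) -> y = helix h (rad y) (F (rad y)) theta ->
   (y 0 0 * cos (Z_at y) + y 0 1 * sin (Z_at y)) / rad y = cos (Z_at y - theta) /\
   (y 0 0 * sin (Z_at y) - y 0 1 * cos (Z_at y)) / rad y = sin (Z_at y - theta).
  by move=> Jy yE; exact: helix_phase (rad0 _ Jy) yE.
have [B1 B2] := spread q psi Jrq qE; have [C1 C2] := spread p psi0 Jp pE.
have E0 : (0 < T_at q ^+ 2 - a) = (0 < T_at p ^+ 2 - a).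
  rewrite -(TE q Sq Uq) -(TE p Sp Up); apply: (interval_sign (f := fun x =>
    tau a (fun x => c * dF x) (fun x => c * d2F x) x ^+ 2 - a) iJ _ tau2 Jrq Jp) => z Jz.
  have ct := tau_continuous (a := a) (DdFc c) (Dd2Fc c) (JA _ Jz).
  exact: (continuousB (continuousM ct ct) (@cst_continuous _ _ a z)).
have := profile_radius JA iJ nJ J0 (DdFc c) (Dd2Fc c) (cd3Fc c) aN1
    (odeE _ ch) tau_pos Jrq Jp.
rewrite (TE q Sq Uq) (TE p Sp Up) => E1.
have E2 := etrans B1 (etrans (congr1 cos ZpE) (esym C1)).
have E3 := etrans B2 (etrans (congr1 sin ZpE) (esym C2)).
exact (f_equal2 pair (f_equal2 pair (f_equal2 pair (sgq q Sq Uq) E0) E1)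
  (f_equal2 pair E2 E3)).
Qed.

Lemma necessity_generic : exists (I : set R) (T : set 'rV[R]_3),
  [/\ parameter_interval a I, T `<=` surface_r_a a I & iso_similar S T].
Proof.
have [[p Sp] conS _] := surfS.
have a1 : a + 1 != 0 by rewrite -[1]opprK subr_eq0.
have inv q : S q -> [/\ 0 < T_at q, T_at q ^+ 2 != a & invariant q = invariant p].
  move=> Sq; have [U [oU Uq /(_ q Sq Uq)[T0 Ta _]]] := invariant_local Sq; split=> //.
  apply: (connected_constant conS) => // y Sy.
  have [V [oV Vy HV]] := invariant_local Sy.
  by exists V; split=> // z Sz Vz; have [] := HV z Sz Vz.
have q0 q : S q -> 0 < rad q.
  by move=> Sq; rewrite sqrtr_gt0; exact: (helical_axis h0 hel Sq (graph Sq)).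
have hx q : S q -> exists psi, q = helix h (rad q) (q 0 2 - h * psi) psi.
  by move=> Sq; apply: helix_exists; exact: (helical_axis h0 hel Sq (graph Sq)).
have spread q psi : S q -> q = helix h (rad q) (q 0 2 - h * psi) psi ->
   (q 0 0 * cos (Z_at q) + q 0 1 * sin (Z_at q)) / rad q = cos (Z_at q - psi) /\
   (q 0 0 * sin (Z_at q) - q 0 1 * cos (Z_at q)) / rad q = sin (Z_at q - psi).
  by move=> Sq qE; apply: helix_phase qE; rewrite gt_eqF ?q0.
have [T0 Ta _] := inv p Sp; have [psi0 pE] := hx p Sp.
have [P1 P2] := spread p psi0 Sp pE.
(* These constants define the similarity: [k0] is the excess of [Z_at] over the polar angle, and
   [I1] is the value of log r + log (cos u sin^a u) / (a + 1), so that division by [C] turns r into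
   the radius of [r_a]. *)
pose k0 := Z_at p - psi0; pose e := eps p.
pose I1 := ln (rad p) - ln (1 + T_at p ^+ 2) / 2 + a / (a + 1) * ln (T_at p).
pose C := expR I1; have C0 : 0 < C by exact: expR_gt0.
have e2 : e * e = 1 by rewrite -expr2 sqrr_sign.
pose g q := pt3 (q 0 0 / C) (e * (q 0 1 / C)) (e * (q 0 2 / h - k0)).
exists (ra_component a (T_at p)), (g @` S); split.
- exact: parameter_interval_component.
- move=> _ [q Sq <-]; have [Tq0 Tqa invq] := inv q Sq.
  have [psi qE] := hx q Sq; have [Q1 Q2] := spread q psi Sq qE.
  have sg := congr1 (fun t => t.1.1.1) invq; have sgT := congr1 (fun t => t.1.1.2) invq.
  have I1E := congr1 (fun t => t.1.2) invq.
  have cE := congr1 (fun t => t.2.1) invq; have sE := congr1 (fun t => t.2.2) invq.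
  rewrite /= in sg sgT I1E cE sE; rewrite P1 Q1 in cE; rewrite P2 Q2 in sE.
  have [x0E x1E] := helix_spread (ltW (q0 q Sq)) qE cE sE.
  (* [Z_at q - k0] is a polar angle of [q], and the reflection contained in [g] multiplies it by
     [e]. *)
  exists (atan (T_at q)), (e * (Z_at q - k0)); split.
    by split; [exact: atan_gt0|rewrite atanK|rewrite atanK].
  have eq : eps q = e by rewrite /e /eps sg.
  have ce y : cos (e * y) = cos y.
    by rewrite /e /eps; case: (0 < _); rewrite /= ?expr0 ?expr1 ?mul1r ?mulN1r ?cosN.
  have se y : sin (e * y) = e * sin y.
    by rewrite /e /eps; case: (0 < _); rewrite /= ?expr0 ?expr1 ?mul1r ?mulN1r ?sinN.
  rewrite (r_a_atan _ a1 Tq0); have xC : rad q / C = ra_radius a (T_at q).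
    rewrite /ra_radius /C -[rad q](lnK (q0 q Sq)) -expRN -expRD; congr expR.
    have : ln (rad q) - ln (1 + T_at q ^+ 2) / 2 + a / (a + 1) * ln (T_at q) = I1.
      transitivity (((a + 1) * ln (rad q) - (a + 1) / 2 * ln (1 + T_at q ^+ 2)
        + a * ln (T_at q)) / (a + 1)); first by field.
      by rewrite I1E /I1; field.
    by move=> <-; ring.
  apply: pt3_eq; rewrite !ptE -?xC ?ce ?se ?x0E ?x1E.
  + by rewrite mulrAC.
  + by ring.
  + rewrite /Z_at eq; transitivity (e * e * ra_height a (T_at q)
      + e * (q 0 2 / h - e * ra_height a (T_at q) - k0)); first by ring.
    by rewrite e2; ring.
- exists g; split=> //; apply: (@similarity_spread e C k0 g (~~ (0 < tau_at p))) => //.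
  by rewrite gt_eqF.
Qed.

End Generic.

(** The invariants are the slope s, which becomes the constant c, and the phase of z / h - s log r
    relative to the polar angle. The similarity divides the height by h and translates it, fixing x
    and y. *)
Lemma necessity_minus1 : a = -1 -> exists (c : R) (T : set 'rV[R]_3),
  T `<=` surface_r_c c /\ iso_similar S T.
Proof.
move=> aE; have [[p Sp] conS _] := surfS.
have q0 q : S q -> 0 < rad q.
  by move=> Sq; rewrite sqrtr_gt0; exact: (helical_axis h0 hel Sq (graph Sq)).
have hx q : S q -> exists psi, q = helix h (rad q) (q 0 2 - h * psi) psi.
  by move=> Sq; apply: helix_exists; exact: (helical_axis h0 hel Sq (graph Sq)).
pose Z_at q := q 0 2 / h - slope_at q * ln (rad q).
pose inv q := (slope_at q,
   ((q 0 0 * cos (Z_at q) + q 0 1 * sin (Z_at q)) / rad q,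
    (q 0 0 * sin (Z_at q) - q 0 1 * cos (Z_at q)) / rad q)).
have spread q psi : S q -> q = helix h (rad q) (q 0 2 - h * psi) psi ->
   (q 0 0 * cos (Z_at q) + q 0 1 * sin (Z_at q)) / rad q = cos (Z_at q - psi) /\
   (q 0 0 * sin (Z_at q) - q 0 1 * cos (Z_at q)) / rad q = sin (Z_at q - psi).
  by move=> Sq qE; apply: helix_phase qE; rewrite gt_eqF ?q0.
have invE q : S q -> inv q = inv p.
  move=> Sq; apply: (connected_constant conS) => // {Sp Sq p q} p Sp.
  have [U [J [A [F [[oU Up HU] [[Jp iJ nJ J0] [oA JA [dF [d2F [d3F
    [DF DdF Dd2F cd3F ode]]]]]]]]]]] := profile_at Sp.
  exists U; split=> // q Sq Uq.
  have hV : (h^-1 * h) ^+ 2 = 1 by rewrite mulVf// expr1n.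
  have [sLE oE] := ode _ hV.
  have [Jrq [psi qE]] := HU q Sq Uq; have [_ [psi0 pE]] := HU p Sp Up.
  pose dG x := h^-1 * dF x.
  have DG x : A x -> is_derive x 1 (fun x => h^-1 * F x) (dG x).
    by move=> Ax; apply: is_derive_scale; exact: DF.
  have DdG x : A x -> is_derive x 1 dG (h^-1 * d2F x).
    by move=> Ax; apply: is_derive_scale; exact: DdF.
  have sc x y : J x -> J y -> slope dG x = slope dG y.
    move=> Jx Jy; apply: (is_derive_cst_interval iJ _ Jx Jy) => z Jz.
    apply: (is_derive_eq (is_derive_slope DdG (JA _ Jz))).
    (* The derivative of the slope times z is the trace, that is, (1 + a) k = 0. *)
    have [k [kE _]] := oE z Jz; move: kE; rewrite aE subrr mul0r /trace_fun => kE.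
    have z0 : z != 0 by rewrite gt_eqF// J0.
    apply: (mulfI z0); rewrite mulr0 -kE /dG; ring.
  have sE y : S y -> U y -> slope_at y = slope dG (rad p).
    move=> Sy Uy; have [+ _] := sLE y Sy Uy; rewrite mulVf// mul1r => <-.
    by apply: sc => //; have [] := HU y Sy Uy.
  pose s := slope dG (rad p).
  have hc : h^-1 * F (rad q) - s * ln (rad q) = h^-1 * F (rad p) - s * ln (rad p).
    apply: (@is_derive_cst_interval R J (fun x => h^-1 * F x - s * ln x)
      (rad q) (rad p)) => // z Jz.
    have z0 := J0 z Jz.
    apply: (is_derive_eq (is_deriveB (DG z (JA _ Jz))
      (is_derive_scale s (is_derive1_ln z0)))).
    by rewrite /s -(sc z (rad p) Jz Jp) /slope; field; rewrite gt_eqF.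
  have ZE y theta : S y -> U y -> y = helix h (rad y) (F (rad y)) theta ->
      Z_at y - theta = h^-1 * F (rad y) - s * ln (rad y).
    by move=> Sy Uy yE; rewrite /Z_at sE// {1}yE ptE -/s; field.
  have toz y theta : y = helix h (rad y) (F (rad y)) theta ->
      y = helix h (rad y) (y 0 2 - h * theta) theta.
    by move=> yE; rewrite {1}yE; congr helix; rewrite {2}yE ptE addrK.
  have [B1 B2] := spread q psi Sq (toz _ _ qE).
  have [C1 C2] := spread p psi0 Sp (toz _ _ pE).
  by rewrite /inv B1 B2 C1 C2 (ZE q psi)// (ZE p psi0)// hc !sE.
have [psi0 pE] := hx p Sp; have [P1 P2] := spread p psi0 Sp pE.
pose k0 := Z_at p - psi0.
pose g q := pt3 (q 0 0 / 1) (1 * (q 0 1 / 1)) (1 * (q 0 2 / h - k0)).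
exists (slope_at p), (g @` S); split.
- move=> _ [q Sq <-]; have := invE q Sq.
  have [psi qE] := hx q Sq; have [Q1 Q2] := spread q psi Sq qE.
  rewrite /inv P1 P2 Q1 Q2 => -[slE cE sE].
  have [x0E x1E] := helix_spread (ltW (q0 q Sq)) qE cE sE.
  exists (rad q), (Z_at q - k0); split; first exact: q0.
  apply: pt3_eq; rewrite !ptE ?x0E ?x1E ?divr1 ?mul1r//.
  by rewrite -slE /Z_at; ring.
- by exists g; split=> //; apply: (@similarity_spread 1 1 k0 g false); rewrite ?oner_eq0.
Qed.

End Necessity.

(** * Sufficiency *)

Section Sufficiency.
Variables (R : realType) (a : R) (S : set 'rV[R]_3).
Implicit Types (p q : 'rV[R]_3) (x t : R).

Lemma hessian_scale_affine (f l : 'rV[R]_2 -> R) (dl : 'I_2 -> R)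
    (c : R) (P : set 'rV[R]_2) v : open P -> P v ->
  Ck (delta_row 2) 2 P f ->
  (forall i u, is_derive u (delta_mx 0 i) l (dl i)) ->
  hessian (fun u => c * (f u + l u)) v = c *: hessian f v.
Proof.
move=> oP Pv Cf Dl; apply/matrixP => i j; rewrite [LHS]mxE [RHS]mxE [in RHS]mxE.
have E : {near v, (fun u => 'D_(delta_mx 0 j) (fun u => c * (f u + l u)) u)
    =1 (fun u => c * ('D_(delta_mx 0 j) f u + dl j))}.
  apply: filterS (open_nbhs_nbhs (conj oP Pv)) => u Pu.
  have [_ ->] // := is_derive_scale c
    (is_derive_add (Ck_is_derive j Cf Pu) (Dl j u)).
rewrite (near_eq_derive _ E).
have [_ ->] := is_derive_scale c (is_derive_add
  (Ck_is_derive i (Ck_derive j Cf) Pv) (is_derive_cst (dl j) v (delta_mx 0 i))).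
by rewrite addr0.
Qed.

Variable g : 'rV[R]_3 -> 'rV[R]_3.
Hypothesis simg : iso_similarity g.

Lemma similarity_continuous : continuous g.
Proof.
move: simg => [s [h1 [h2 [c1 [c2 [c3 [b [_ gE]]]]]]]] q.
have cq i : {for q, continuous (fun q : 'rV[R]_3 => q 0 i)}.
  exact: coord_continuous.
have cc (k : R) : {for q, continuous (fun _ : 'rV[R]_3 => k)}.
  exact: cst_continuous.
have E q' : pt3 ((-1) ^+ s * h1 * q' 0 0 + - ((-1) ^+ s * h2) * q' 0 1 + b 0 0)
    (h2 * q' 0 0 + h1 * q' 0 1 + b 0 1)
    (c1 * q' 0 0 + c2 * q' 0 1 + c3 * q' 0 2 + b 0 2) = g q'.
  have [E0 E1 E2] := similarity_coord s h1 h2 c1 c2 c3 b q'.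
  by apply: pt3_eq; rewrite !ptE gE ?E0 ?E1 ?E2 ?mulNr.
apply: (continuous_ext E); apply: pt3_continuous.
- exact: (continuousD (continuousD (continuousM (cc _) (cq 0))
    (continuousM (cc _) (cq 1))) (cc _)).
- exact: (continuousD (continuousD (continuousM (cc _) (cq 0))
    (continuousM (cc _) (cq 1))) (cc _)).
- exact: (continuousD (continuousD (continuousD (continuousM (cc _) (cq 0))
    (continuousM (cc _) (cq 1))) (continuousM (cc _) (cq 2))) (cc _)).
Qed.

(** Near [p] the equation saying that [g q] lies on the helical graph of F is solved for the height
    of [q]. This gives a helical function in the coordinates that [g] induces on the plane, plus an
    affine function, all divided by [c3]. *)
Lemma sufficiency_at p (F dF : R -> R) (ddF k v0 : R) (A : set R) : S p ->
  open A -> A (rad (g p)) -> (forall x, A x -> 0 < x) -> Ck1 3 A F ->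
  (forall x, A x -> is_derive x 1 F (dF x)) -> is_derive (rad (g p)) 1 dF ddF ->
  g p = helix 1 (rad (g p)) (F (rad (g p))) v0 ->
  (forall q, S q -> A (rad (g q)) ->
     exists psi, g q = helix 1 (rad (g q)) (F (rad (g q))) psi) ->
  k != 0 -> let r := rad (g p) in
  ddF + dF r / r = (1 + a) * k ->
  ddF * (dF r / r) - (1 / r ^+ 2) ^+ 2 = a * k ^+ 2 ->
  exists f, local_graph S p f /\ ratio_hessian a (hessian f (xy p)).
Proof.
move=> Sp oA Ar A0 CF DF DdF gp HS k0 r tr dt.
have cg := similarity_continuous.
have [s [h1 [h2 [c1 [c2 [c3 [b [/= unit gE]]]]]]]] := simg.
move: unit; rewrite unitmxE unitfE det_similarity !mulf_eq0 !negb_or signr_eq0 /=.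
move=> /andP[nu0 c30].
pose sg : R := (-1) ^+ s.
have sg2 : sg * sg = 1 by rewrite -expr2 sqrr_sign.
pose c := cos v0; pose d := sin v0; have cd : c ^+ 2 + d ^+ 2 = 1 := cos2Dsin2 v0.
(* [X] and [Y] are the plane coordinates of [g q] rotated through - v0. They put [g p] on the
   positive X-axis, where [atan (Y / X)] is a branch of the polar angle. *)
pose A' := c * h1 + sg * d * h2; pose B' := c * h2 - sg * d * h1.
pose X := affine (sg * A') (- (sg * B')) (c * b 0 0 + d * b 0 1).
pose Y := affine B' A' (c * b 0 1 - d * b 0 0).
have XE q : X (xy q) = c * g q 0 0 + d * g q 0 1.
  have [E0 E1 _] := similarity_coord s h1 h2 c1 c2 c3 b q.
  rewrite gE E0 E1 -/sg /X /affine !ptE /A' /B'.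
  transitivity (c * sg * (h1 * q 0 0 - h2 * q 0 1)
    + (sg * sg) * d * (h2 * q 0 0 + h1 * q 0 1) + (c * b 0 0 + d * b 0 1)).
    by ring.
  by rewrite sg2; ring.
have YE q : Y (xy q) = c * g q 0 1 - d * g q 0 0.
  have [E0 E1 _] := similarity_coord s h1 h2 c1 c2 c3 b q.
  by rewrite gE E0 E1 -/sg /Y /affine !ptE /A' /B'; ring.
have XYpsi q psi z : g q = helix 1 (rad (g q)) z psi ->
    X (xy q) = rad (g q) * cos (psi - v0) /\ Y (xy q) = rad (g q) * sin (psi - v0).
  move=> E; have e0 : g q 0 0 = rad (g q) * cos psi by rewrite {1}E ptE.
  have e1 : g q 0 1 = rad (g q) * sin psi by rewrite {1}E ptE.
  by rewrite XE YE e0 e1 cosB sinB /c /d; split; ring.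
have radE q : radius X Y (xy q) = rad (g q).
  rewrite /radius XE YE /rad; congr Num.sqrt.
  transitivity ((c ^+ 2 + d ^+ 2) * (g q 0 0 * g q 0 0 + g q 0 1 * g q 0 1)).
    by ring.
  by rewrite cd mul1r.
have r0 : 0 < r by exact: A0.
pose P := polar_dom X Y A.
have cX : continuous X by exact: affine_continuous.
have cY : continuous Y by exact: affine_continuous.
have oP : open P by exact: polar_dom_open.
have [Xp Yp] := XYpsi p v0 _ gp.
have Pp : P (xy p).
  by split; rewrite ?radE// Xp subrr cos0 mulr1.
have CH : Ck (delta_row 2) 3 P (helical_fun X Y F 1).
  exact: (Ck_helical_fun cX cY (@is_derive_affine _ _ _ _) (@is_derive_affine _ _ _ _)).
(* [l] cancels the affine terms in the third coordinate of [g] and adds [v0], from which the angle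
   of (X, Y) is measured. *)
pose l := affine (- c1) (- c2) (v0 - b 0 2).
pose f u := c3^-1 * (helical_fun X Y F 1 u + l u).
exists f; split; last first.
  have Hf : hessian f (xy p) = c3^-1 *: hessian (helical_fun X Y F 1) (xy p).
    by apply: (hessian_scale_affine (P := P) _ oP Pp (CkS CH)) => i u;
      exact: is_derive_affine.
  have DdF' : is_derive (radius X Y (xy p)) 1 dF ddF by rewrite radE.
  have [T D] := conformal_hessian 1 oA Pp DF DdF'.
  have nuE : A' ^+ 2 + B' ^+ 2 = h1 ^+ 2 + h2 ^+ 2.
    rewrite /A' /B'; transitivity ((c ^+ 2 + (sg * sg) * d ^+ 2) * (h1 ^+ 2 + h2 ^+ 2)).
      by ring.
    by rewrite sg2 mul1r cd mul1r.
  rewrite radE nuE tr in T; rewrite radE nuE dt in D.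
  exists (c3^-1 * (h1 ^+ 2 + h2 ^+ 2) * k); split.
  - by rewrite !mulf_neq0 ?invr_neq0.
  - rewrite Hf; set H := hessian _ _ in T *.
    have M i j : (c3^-1 *: H) i j = c3^-1 * H i j by rewrite mxE.
    by rewrite !M -mulrDr T; ring.
  - rewrite Hf; set H := hessian _ _ in D *.
    have M i j : (c3^-1 *: H) i j = c3^-1 * H i j by rewrite mxE.
    rewrite !M; transitivity (c3^-1 ^+ 2 * (H 0 0 * H 1 1 - H 0 1 * H 1 0)); first by ring.
    by rewrite D; ring.
split.
  have Cl : Ck (delta_row 2) 3 P l.
    exact: (Ck_affine 3 oP (@affine_continuous _ _ _ _) (@is_derive_affine _ _ _ _)).
  have Cf : Ck (delta_row 2) 3 P f := CkZ c3^-1 oP (CkD oP CH Cl).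
  by exists P; split; [exact: oP|exact: Pp|exact: ((Ck_onE _ _ _).2 Cf)].
have crg q : {for q, continuous (fun q => rad (g q))}.
  by apply: (@continuous_comp _ _ _ g (@rad R)); [exact: cg|exact: rad_continuous].
(* On the surface [phase] is the helix parameter psi. Keeping it within pi / 2 of [v0] isolates the
   turn through [g p], on which [atan] recovers psi - v0. *)
pose phase q := g q 0 2 - F (rad (g q)).
have cphase q : A (rad (g q)) -> {for q, continuous phase}.
  move=> Aq; apply: continuousB.
    apply: (@continuous_comp _ _ _ g (fun t : 'rV[R]_3 => t 0 2)); first exact: cg.
    exact: coord_continuous.
  by apply: (@continuous_comp _ _ _ (fun q => rad (g q)) F); [exact: crg|
    exact: (Ck_continuous CF Aq)].
pose U := [set q | A (rad (g q)) /\ `]v0 - pi / 2, v0 + pi / 2[%classic (phase q)].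
exists U; split.
- rewrite openE => q [Aq phq].
  have n1 : nbhs q [set q' | A (rad (g q'))].
    exact: (nbhs_preimage (crg q) oA Aq).
  have oI : open `]v0 - pi / 2, v0 + pi / 2[%classic by exact: interval_open.
  have n2 := nbhs_preimage (cphase q Aq) oI phq.
  by apply: filterS (filterI n1 n2) => q' [].
- split=> //; rewrite /phase {1}gp ptE mul1r addrAC subrr add0r /= in_itv /=.
  by have := pi_gt0 R => pi0; apply/andP; split; lra.
move=> q Sq [Aq]; have [psi qE] := HS q Sq Aq.
have -> : phase q = psi by rewrite /phase {1}qE ptE mul1r addrAC subrr add0r.
rewrite /= in_itv /= => /andP[ps1 ps2].
have [Xq Yq] := XYpsi q psi _ qE; have rq := A0 _ Aq.
have cp : 0 < cos (psi - v0) by apply: cos_gt0_pihalf; apply/andP; split; lra.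
have anE : atan (Y (xy q) / X (xy q)) = psi - v0.
  rewrite Xq Yq -mulf_div divff ?gt_eqF// mul1r -/(tan _) tanK// in_itv /=.
  by apply/andP; split; lra.
have [_ _ E2] := similarity_coord s h1 h2 c1 c2 c3 b q; rewrite -gE in E2.
have : g q 0 2 = F (rad (g q)) + psi by rewrite {1}qE ptE mul1r.
rewrite E2 /f /helical_fun anE radE /l /affine !ptE => E3.
transitivity (c3^-1 * (c1 * q 0 0 + c2 * q 0 1 + c3 * q 0 2 + b 0 2
   - c1 * q 0 0 - c2 * q 0 1 - b 0 2)); first by field.
by rewrite E3; congr (_ * _); ring.
Qed.

End Sufficiency.

(** * Inversion of the radius of the generatrix *)

Section RadiusInverse.
Variables (R : realType) (a : R) (b : bool).
Hypotheses (a1 : a + 1 != 0) (am1 : a - 1 != 0).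
Implicit Types (t r x : R).

Let K := [set t : R | [/\ 0 < t, t ^+ 2 != a & (0 < t ^+ 2 - a) = b]].
Let rho := ra_radius a.
Let drho t := rho t * ((t ^+ 2 - a) / ((a + 1) * t * (1 + t ^+ 2))).

Let K_between t t' z : K t -> K t' -> t <= z <= t' -> K z.
Proof.
move=> [t0 ta ts] [t0' ta' ts'] /andP[tz zt]; have z0 : 0 < z by exact: lt_le_trans tz.
have tz2 : t ^+ 2 <= z ^+ 2 by rewrite ler_sqr// nnegrE ltW.
have zt2 : z ^+ 2 <= t' ^+ 2 by rewrite ler_sqr// nnegrE ltW.
case E : b in ts ts'.
  have h0 : 0 < z ^+ 2 - a by apply: lt_le_trans (_ : t ^+ 2 - a <= _); rewrite ?ts ?lerD2r.
  by split; rewrite ?h0 ?E// -subr_eq0 gt_eqF.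
have h0 : z ^+ 2 - a < 0.
  have : t' ^+ 2 - a < 0 by rewrite lt_neqAle subr_eq0 ta' leNgt ts'.
  by apply: le_lt_trans; rewrite lerD2r.
by split=> //; [rewrite -subr_eq0 lt_eqF|rewrite E; apply/negbTE; rewrite -leNgt ltW].
Qed.

Let K_open : open K.
Proof.
have ct (t : R) : {for t, continuous (fun t : R => t ^+ 2 - a)}.
  exact: (continuousB (continuousM (@cvg_id _ _) (@cvg_id _ _)) (@cst_continuous _ _ a t)).
rewrite openE => t [t0 ta ts].
have n1 : nbhs t [set t : R | 0 < t] by apply: open_nbhs_nbhs; split=> //; exact: open_gt.
case E : b in ts.
  have n2 := nbhs_preimage (ct t) (@open_gt _ (0 : R)) ts.
  apply: filterS (filterI n1 n2) => z [z0 za]; split=> //; last by rewrite E.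
  by rewrite -subr_eq0 gt_eqF.
have ts' : t ^+ 2 - a < 0 by rewrite lt_neqAle subr_eq0 ta leNgt ts.
have n2 := nbhs_preimage (ct t) (@open_lt _ (0 : R)) ts'.
apply: filterS (filterI n1 n2) => z [z0 /= za]; split=> //.
  by rewrite -subr_eq0 lt_eqF.
by rewrite E; apply/negbTE; rewrite -leNgt ltW.
Qed.

Lemma is_derive_ra_radius t : 0 < t -> is_derive t 1 rho (drho t).
Proof.
move=> t0; have q0 : 0 < 1 + t * t by rewrite ltr_wpDr// -expr2 sqr_ge0.
have Did : is_derive t (1 : R) (fun y : R => y) 1 by exact: is_derive_id.
have D1 := @is_derive_comp R R (@ln R) (fun y => 1 + y * y) t 1 _ _
  (is_derive1_ln q0)
  (is_derive_add (is_derive_cst (1 : R) t 1) (is_derive_mul Did Did)).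
have D2 := is_derive_mul D1 (is_derive_cst (2^-1 : R) t 1).
have D3 := is_deriveB D2 (is_derive_scale (a / (a + 1)) (is_derive1_ln t0)).
have D4 := is_derive_comp (is_derive_expR _) D3.
apply: (is_derive_eq D4).
rewrite /drho /rho /ra_radius expr2; congr (expR _ * _).
by rewrite /cst; field; rewrite a1 !gt_eqF.
Qed.

Let drho_neq0 t : K t -> drho t != 0.
Proof.
move=> [t0 ta _]; apply: mulf_neq0; first by rewrite gt_eqF// expR_gt0.
apply: mulf_neq0; first by rewrite subr_eq0.
rewrite invr_neq0// !mulf_neq0// ?(gt_eqF t0)// gt_eqF//.
by rewrite ltr_wpDr// sqr_ge0.
Qed.

Let rho_inj t t' : K t -> K t' -> rho t = rho t' -> t = t'.
Proof.
have H u u' : K u -> K u' -> rho u = rho u' -> u < u' -> False.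
  move=> Ku Ku' E uu.
  have Kz z : z \in `[u, u'] -> K z by rewrite in_itv /=; exact: K_between.
  have Dr z : z \in `]u, u'[ -> is_derive z 1 rho (drho z).
    by move=> zuu; apply: is_derive_ra_radius; have [] := Kz z (subset_itv_oo_cc zuu).
  have cr : {within `[u, u'], continuous rho}.
    apply: continuous_in_subspaceT => z; rewrite inE => /Kz[z0 _ _].
    exact: is_derive1_continuous (is_derive_ra_radius z0).
  have [z zuu] := MVT uu Dr cr.
  rewrite E subrr => /esym/eqP; rewrite mulf_eq0 subr_eq0.
  rewrite (negbTE (drho_neq0 (Kz z (subset_itv_oo_cc zuu)))) /=.
  by rewrite gt_eqF.
by move=> Kt Kt' E; case: (ltgtP t t') => // tt; [case: (H t t')|case: (H t' t)].
Qed.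

Let A := rho @` K.
Let inv r := xget 0 [set t | K t /\ rho t = r].

Let invK t : K t -> inv (rho t) = t.
Proof.
move=> Kt; have [] : [set t' | K t' /\ rho t' = rho t] (inv (rho t)).
  by apply: xgetPex; exists t.
by move=> Ki; exact: rho_inj.
Qed.

Let A_inv r : A r -> K (inv r) /\ rho (inv r) = r.
Proof. by move=> [t Kt <-]; rewrite invK. Qed.

Let near_K t : K t -> {near t, cancel rho inv}.
Proof.
by move=> Kt; apply: filterS (open_nbhs_nbhs (conj K_open Kt)) => z; exact: invK.
Qed.

Let near_cont t : K t -> {near t, continuous rho}.
Proof.
move=> Kt; apply: filterS (open_nbhs_nbhs (conj K_open Kt)) => z [z0 _ _].
exact: is_derive1_continuous (is_derive_ra_radius z0).
Qed.

Let A_open : open A.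
Proof.
rewrite openE => _ [t Kt <-].
have [c1 c2] := near_can_continuousAcan_sym (near_K Kt) (near_cont Kt).
have ci : {for rho t, continuous inv} := nbhs_singleton c1.
have n1 : nbhs (rho t) (inv @^-1` K) by apply: nbhs_preimage; rewrite ?invK.
by apply: filterS (filterI n1 c2) => r [Kr E]; exists (inv r).
Qed.

Let A_gt0 r : A r -> 0 < r.
Proof. by move=> [t _ <-]; exact: expR_gt0. Qed.

(** For t = inv r this is the differential equation [tau_ode] again, now obtained from the
    derivative of an inverse function. *)
Let is_derive_inv_radius r : A r -> is_derive r 1 inv
  ((a + 1) * (inv r * (1 + inv r * inv r)) * (r * (inv r * inv r - a))^-1).
Proof.
move=> Ar; have [Kt E] := A_inv Ar; have [t0 ta _] := Kt.
have D := is_derive_inverse (near_K Kt) (near_cont Kt) (is_derive_ra_radius t0)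
  (drho_neq0 Kt).
rewrite E in D; apply: (is_derive_eq D).
rewrite /drho E; field.
have r0 := A_gt0 Ar; have q0 : 0 < 1 + inv r ^+ 2 by rewrite ltr_wpDr// sqr_ge0.
by rewrite a1 subr_eq0 ta !gt_eqF//.
Qed.

(** The derivative of [inv] is a rational function of r and [inv r], so each order of smoothness
    yields the next. *)
Let Ck_inv_radius k : Ck1 k A inv.
Proof.
elim: k => [|k IH].
  by split=> // r Ar; exact: is_derive1_continuous (is_derive_inv_radius Ar).
apply: (Ck1_intro A_open is_derive_inv_radius).
have oA := A_open; have Cid : Ck1 k A id by exact: Ck1_id.
have cst c : Ck1 k A (fun=> c) by exact: Ck_cst.
have C2 : Ck1 k A (fun r => inv r * inv r) := CkM oA IH IH.
have CV : Ck1 k A (fun r => (r * (inv r * inv r - a))^-1).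
  apply: (Ck_comp oA _ (Ck1V R k) (CkM oA Cid (CkB oA C2 (cst a)))) => r Ar.
  have [[t0 ta _] _] := A_inv Ar.
  by rewrite /= mulf_neq0 ?subr_eq0// gt_eqF// A_gt0.
exact: (CkM oA (CkM oA (cst (a + 1)) (CkM oA IH (CkD oA (cst 1) C2))) CV).
Qed.

Lemma ra_profile : exists F dF : R -> R,
  [/\ open A, forall r, A r -> 0 < r, Ck1 3 A F,
      forall r, A r -> is_derive r 1 F (dF r) &
      forall t, K t -> [/\ A (rho t), F (rho t) = ra_height a t &
        exists ddF k, [/\ is_derive (rho t) 1 dF ddF, k != 0,
          ddF + dF (rho t) / rho t = (1 + a) * k &
          ddF * (dF (rho t) / rho t) - (1 / rho t ^+ 2) ^+ 2 = a * k ^+ 2]]].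
Proof.
pose F r := ra_height a (inv r).
(* The relation (a - 1) r F' = t + a / t of [tau_slope], solved for F'. *)
pose dF r := (inv r + a * (inv r)^-1) * ((a - 1) * r)^-1.
have a2 : a ^+ 2 - 1 != 0 by rewrite subr_sqr_1 mulf_neq0// addrC.
exists F, dF; split.
- exact: A_open.
- exact: A_gt0.
- have CV : Ck1 3 A (fun r => (inv r)^-1).
    apply: (Ck_comp A_open _ (Ck1V R 3)) (Ck_inv_radius 3) => r Ar.
    by have [[t0 _ _] _] := A_inv Ar; rewrite /= gt_eqF.
  have oA := A_open; have cst c : Ck1 3 A (fun=> c) by exact: Ck_cst.
  have Ci := Ck_inv_radius 3.
  have Ca : Ck1 3 A (fun r => atan (inv r)).
    exact: (Ck_comp oA _ (Ck1_atan R 3) Ci).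
  exact: (CkD oA (CkD oA Ca (CkM oA Ci (cst _))) (CkM oA (cst _) CV)).
- move=> r Ar; have [[t0 ta _] E] := A_inv Ar; have D := is_derive_inv_radius Ar.
  have D1 := is_derive_comp (is_derive1_atan (inv r)) D.
  have D2 := is_derive_mul D (is_derive_cst (a ^+ 2 - 1)^-1 r 1).
  have D3 := is_derive_scale (a ^+ 2 / (a ^+ 2 - 1)) (is_derive_inv (lt0r_neq0 t0) D).
  apply: (is_derive_eq (is_derive_add (is_derive_add D1 D2) D3)).
  have q0 : 0 < 1 + inv r ^+ 2 by rewrite ltr_wpDr// sqr_ge0.
  rewrite /dF /cst; field.
  have ta' : inv r * inv r - a != 0 by rewrite -expr2 subr_eq0.
  by rewrite am1 a2 ta' (gt_eqF (A_gt0 Ar)) (gt_eqF t0) gt_eqF.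
move=> t Kt; have [t0 ta _] := Kt; have Ar : A (rho t) by exists t.
have r0 := A_gt0 Ar; set r := rho t in Ar r0 *.
have it : inv r = t by exact: invK.
have q0 : 0 < 1 + t ^+ 2 by rewrite ltr_wpDr// sqr_ge0.
have ta' : t * t - a != 0 by rewrite -expr2 subr_eq0.
split=> //; first by rewrite /F it.
have D := is_derive_inv_radius Ar; rewrite it in D.
have i0 : inv r != 0 by rewrite it gt_eqF.
have c0 : (a - 1) * r != 0 by rewrite mulf_neq0// gt_eqF.
have D1 := is_derive_add D (is_derive_scale a (is_derive_inv i0 D)).
have Did : is_derive r (1 : R) (fun y : R => y) 1 by exact: is_derive_id.
have D2 := is_derive_mul D1 (is_derive_inv c0 (is_derive_scale (a - 1) Did)).
(* The eigenvalue comes from (a - 1) k = t + 1 / t in [tau_kappa], divided by r^2 because the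
   profile equations concern r^2 times the Hessian. *)
eexists; exists ((t + t^-1) / ((a - 1) * r ^+ 2)); split; first exact: D2.
- apply: mulf_neq0; first by rewrite gt_eqF// addr_gt0// invr_gt0.
  by rewrite invr_neq0// mulf_neq0// expf_neq0// gt_eqF.
- rewrite /dF it; field.
  by rewrite am1 (gt_eqF t0) (gt_eqF r0) ta'.
- rewrite /dF it; field.
  by rewrite am1 (gt_eqF t0) (gt_eqF r0) ta'.
Qed.

End RadiusInverse.

(** * Sufficiency for the two families of surfaces *)

Lemma constant_ratio_intro (R : realType) (a : R) (S : set 'rV[R]_3) : a != 0 ->
  (forall p, S p -> exists f, local_graph S p f /\ ratio_hessian a (hessian f (xy p))) ->
  constant_ratio a S.
Proof.
move=> a0 H p Sp; have [f [gf /(ratio_hessianP _ a0)[k1 [k2 [cp k12 ka]]]]] := H p Sp.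
by exists k1, k2; split=> //; exists f.
Qed.

(** On the interval [I] the function tan^2 u - a has no zero and keeps its sign, so a single inverse
    of the radius serves all of [I]. *)
Lemma sufficiency_r_a (R : realType) (a : R) (S : set 'rV[R]_3) (I : set R)
    (g : 'rV[R]_3 -> 'rV[R]_3) : a != 0 -> a != 1 -> a != -1 ->
  parameter_interval a I -> iso_similarity g ->
  (forall q, S q -> surface_r_a a I (g q)) -> constant_ratio a S.
Proof.
move=> a0 an1 aN1 [iI _ I01 Ia] simg gS; apply: constant_ratio_intro => // p Sp.
have a1 : a + 1 != 0 by rewrite -[1]opprK subr_eq0.
have am1 : a - 1 != 0 by rewrite subr_eq0.
have [u0 [v0 [Iu0 gp]]] := gS p Sp.
have sgI u : I u -> (0 < tan u ^+ 2 - a) = (0 < tan u0 ^+ 2 - a).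
  move=> Iu; apply: (interval_sign (f := fun u => tan u ^+ 2 - a) iI) => // z Iz.
    have ct : {for z, continuous (@tan R)}.
      apply: continuous_tan; rewrite gt_eqF// cos_gt0_pihalf//.
      by have := pihalf_itv (I01 z Iz); rewrite in_itv.
    exact: (continuousB (continuousM ct ct) (@cst_continuous _ _ a z)).
  by rewrite subr_eq0; exact: Ia.
have [F [dF [oA A0 CF DF HF]]] := ra_profile (0 < tan u0 ^+ 2 - a) a1 am1.
set A := _ @` _ in oA A0 CF DF HF.
have raE u v : I u -> r_a a u v =
    helix 1 (ra_radius a (tan u)) (ra_height a (tan u)) v.
  move=> Iu; have u01 := I01 u Iu; rewrite -{1}(tanK (pihalf_itv u01)).
  by rewrite r_a_atan// tan_gt0_pihalf.
have HK u : I u -> [/\ A (ra_radius a (tan u)),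
    F (ra_radius a (tan u)) = ra_height a (tan u) &
    exists ddF k, [/\ is_derive (ra_radius a (tan u)) 1 dF ddF, k != 0,
      ddF + dF (ra_radius a (tan u)) / ra_radius a (tan u) = (1 + a) * k &
      ddF * (dF (ra_radius a (tan u)) / ra_radius a (tan u))
        - (1 / ra_radius a (tan u) ^+ 2) ^+ 2 = a * k ^+ 2]].
  by move=> Iu; apply: HF; split; [exact/tan_gt0_pihalf/I01|exact: Ia|exact: sgI].
have radE u v : I u -> rad (r_a a u v) = ra_radius a (tan u).
  by move=> Iu; rewrite raE// rad_helix// expR_ge0.
have [Ap Fp [ddF [k [DdF k0 tr dt]]]] := HK u0 Iu0.
apply: (@sufficiency_at R a S g simg p F dF ddF k v0 A) => //.
- by rewrite gp radE.
- by rewrite gp radE.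
- by rewrite gp radE// raE// Fp.
- move=> q Sq _; have [u [v [Iu ->]]] := gS q Sq; exists v.
  by have [_ Fq _] := HK u Iu; rewrite radE// raE// Fq.
- by rewrite gp radE.
- by rewrite gp radE.
Qed.

Lemma sufficiency_r_c (R : realType) (c : R) (S : set 'rV[R]_3)
    (g : 'rV[R]_3 -> 'rV[R]_3) : iso_similarity g ->
  (forall q, S q -> surface_r_c c (g q)) -> constant_ratio (-1) S.
Proof.
move=> simg gS; apply: constant_ratio_intro => [|p Sp]; first by rewrite oppr_eq0 oner_eq0.
have [u0 [v0 [u00 gp]]] := gS p Sp.
have rcE u v : r_c c u v = helix 1 u (c * ln u) v.
  by apply: pt3_eq; rewrite !ptE ?mul1r.
have radE u v : 0 < u -> rad (r_c c u v) = u.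
  by move=> u0'; rewrite rcE rad_helix// ltW.
have oA : open [set x : R | 0 < x] by exact: open_gt.
have q0 : 0 < 1 + c ^+ 2 by rewrite ltr_pwDl// sqr_ge0.
(* For F = c log r the Hessian of the helical function has trace 0 and determinant - (1 + c^2) /
   r^4, so its eigenvalues are [k] and [- k]. *)
pose k := Num.sqrt (1 + c ^+ 2) / u0 ^+ 2.
apply: (@sufficiency_at R (-1) S g simg p (fun x => c * ln x) (fun x => c * x^-1)
  (c * (- u0 ^- 2 * 1)) k v0 [set x | 0 < x]) => //.
- by rewrite gp radE.
- exact: (CkZ c oA (Ck1_ln R 3)).
- by move=> x x0; apply: is_derive_scale; exact: is_derive1_ln.
- rewrite gp radE//; apply: is_derive_scale; apply: is_derive_inv.
    by rewrite gt_eqF.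
- by rewrite gp radE// rcE.
- by move=> q Sq _; have [u [v [u0' ->]]] := gS q Sq; exists v; rewrite radE// rcE.
- by rewrite /k mulf_neq0 ?invr_neq0 ?expf_neq0// gt_eqF// sqrtr_gt0.
- by rewrite gp radE// subrr mul0r; field; rewrite gt_eqF.
- rewrite gp radE// /k [(Num.sqrt _ / _) ^+ 2]expr_div_n sqr_sqrtr ?ltW//; field.
  by rewrite gt_eqF.
Qed.

Theorem theorem22 (R : realType) (a : R) (ha : a != 0)
    (S : set 'rV[R]_3) (h : R) (hS : surface S) (hadm : admissible S)
    (hh : h != 0) (hhel : helical h S) :
  constant_ratio a S <->
  (a != 1 /\ a != -1 /\
     exists (I : set R) (T : set 'rV[R]_3),
       [/\ parameter_interval a I, T `<=` surface_r_a a I & iso_similar S T])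
  \/
  (a = -1 /\
     exists (c : R) (T : set 'rV[R]_3),
       T `<=` surface_r_c c /\ iso_similar S T).
Proof.
split=> [rat|].
  have [f Hf] := constant_ratio_graphs ha rat.
  have graph q (Sq : S q) := (Hf q Sq).1; have curv q (Sq : S q) := (Hf q Sq).2.
  have [aN1|aN1] := eqVneq a (-1).
    by right; split=> //; exact: (necessity_minus1 hh hS hhel graph curv aN1).
  left; split; first exact: (ratio_neq1 hh hS hhel graph curv).
  by split=> //; exact: (necessity_generic hh hS hhel graph curv aN1).
move=> [[a1 [aN1 [I [T [pI TI [g [simg gST]]]]]]]|[-> [c [T [Tc [g [simg gST]]]]]]].
  by apply: (sufficiency_r_a ha a1 aN1 pI simg) => q Sq; apply: TI; rewrite -gST; exists q.
by apply: (sufficiency_r_c simg) => q Sq; apply: Tc; rewrite -gST; exists q.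
Qed.
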